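(* Let $0<\alpha<n$ and $r=\frac{n}{n-\alpha}$. Let $\nu$ be a signed measure on $\mathbb{R}^n$ that is absolutely continuous with respect to Lebesgue measure and satisfies $|\nu|(\mathbb{R}^n)<\infty$. Let $\Omega:\mathbb{R}^n\setminus\{0\}\to\mathbb{R}$ be a measurable function such that (1) $\Omega(\lambda x)=\Omega(x)$ for all $\lambda>0$ and $x\in\mathbb{R}^n\setminus\{0\}$; (2) $\int_{\mathbb{S}^{n-1}}\Omega(\theta)\,d\sigma(\theta)=0$; (3) $\Omega$ satisfies the $L^r_\alpha$-Dini condition. Then $$\lim_{\lambda\to 0_+}\lambda^r\, m(\{x\in\mathbb{R}^n:|T_{\Omega,\alpha}\nu(x)|>\lambda\})=\frac1n\,\|\Omega\|_r^r\,|\nu(\mathbb{R}^n)|^r.$$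
   Context: $m$ is Lebesgue measure on $\mathbb{R}^n$, $\mathbb{S}^{n-1}$ is the unit sphere of $\mathbb{R}^n$, $\sigma$ is its surface (area) measure, and $\|\Omega\|_r=\left(\int_{\mathbb{S}^{n-1}}|\Omega|^r\,d\sigma\right)^{1/r}$. $|\nu|$ denotes the total variation measure of $\nu$. $L^s_\alpha$-Dini condition ($1\le s\le\infty$, $0<\alpha<n$): a function $\Omega$ on $\mathbb{R}^n\setminus\{0\}$ that is homogeneous of degree zero satisfies the $L^s_\alpha$-Dini condition if (i) $\Omega\in L^s(\mathbb{S}^{n-1})$, and (ii) $\int_0^1\frac{\omega_1(\delta)}{\delta^{1+\alpha}}\,d\delta<\infty$, where $$\omega_1(\delta)=\sup_{\|\rho\|\le\delta}\int_{\mathbb{S}^{n-1}}|\Omega(\rho\theta)-\Omega(\theta)|\,d\sigma(\theta),$$ the supremum being over rotations $\rho$ of $\mathbb{R}^n$ with $\|\rho\|:=\sup\{|\rho x'-x'|:x'\in\mathbb{S}^{n-1}\}\le\delta$. The fractional integral of the measure $\nu$ is defined, for almost every $x$, by $$T_{\Omega,\alpha}\nu(x)=\int\frac{\Omega(x-y)}{|x-y|^{n-\alpha}}\,d\nu(y).$$ *)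

(* Defs.v *)
From HB Require Import structures.
From mathcomp Require Import all_boot all_order all_algebra.
From mathcomp Require Import all_classical all_reals all_analysis.
From mathcomp Require Import measurable_realfun.

Set Implicit Arguments.
Unset Strict Implicit.
Unset Printing Implicit Defensive.

Import Order.TTheory GRing.Theory Num.Theory.
Import numFieldNormedType.Exports.

Local Open Scope classical_set_scope.
Local Open Scope ring_scope.

(** R^n is ['rV[R]_n]. Its default sigma-algebra is the product one, i.e. the
    Borel sigma-algebra; [rVL] below carries the Lebesgue-measurable sets. *)
Section rV_measurable.
Context (R : realType) (n : nat).

Definition rV_coord (i : 'I_n) (x : 'rV[R]_n) : R := x ord0 i.

HB.instance Definition _ := @isMeasurable.Build default_measure_display
  'rV[R]_n (g_sigma_preimage rV_coord)
  (@sigma_algebra0 _ setT _) (@sigma_algebraC _ _)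
  (@sigma_algebra_bigcup _ setT _).

Lemma measurable_rV_coord (i : 'I_n) : measurable_fun setT (rV_coord i).
Proof.
move=> _ A mA; rewrite setTI; apply: sub_sigma_algebra => /=.
rewrite -bigcup_seq/=; exists i => /=; first by rewrite mem_index_enum.
by exists A => //; rewrite setTI.
Qed.

Lemma measurable_to_rV d (T : measurableType d) (f : T -> 'rV[R]_n) :
  (forall i, measurable_fun setT (rV_coord i \o f)) -> measurable_fun setT f.
Proof.
move=> mf _ A mA; rewrite setTI.
have : <<s \big[setU/set0]_(i < n)
    preimage_set_system setT (rV_coord i) measurable >> `<=`
    image_set_system setT f measurable.
  apply: smallest_sub.
    exact/sigma_algebra_image/sigma_algebra_measurable.
  rewrite -bigcup_seq => B [i _ [C mC <-]].
  rewrite /image_set_system /= setTI.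
  by have := mf i measurableT C mC; rewrite !setTI.
by move=> /(_ A mA); rewrite /image_set_system /= setTI.
Qed.

End rV_measurable.

Section borel_lebesgue.
Context (R : realType).

Definition rV_cons n (p : R * 'rV[R]_n) : 'rV[R]_n.+1 :=
  row_mx (p.1%:M : 'M[R]_1) p.2.

Lemma rV_coord_cons0 n (p : R * 'rV[R]_n) : rV_coord ord0 (rV_cons p) = p.1.
Proof.
rewrite /rV_coord /rV_cons (_ : ord0 = lshift n (ord0 : 'I_1)); last exact/val_inj.
by rewrite (@row_mxEl R 1 1 n) mxE eqxx.
Qed.

Lemma rV_coord_consS n (p : R * 'rV[R]_n) (i : 'I_n) :
  rV_coord (lift ord0 i) (rV_cons p) = rV_coord i p.2.
Proof.
rewrite /rV_coord /rV_cons (_ : lift ord0 i = rshift 1 i); last exact/val_inj.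
by rewrite (@row_mxEr R 1 1 n).
Qed.

Lemma measurable_rV_cons n : measurable_fun setT (@rV_cons n).
Proof.
apply: measurable_to_rV => i; case: (unliftP ord0 i) => [j|] ->.
- rewrite (_ : _ \o _ = @rV_coord R n j \o snd); last first.
    by apply/funext => p /=; rewrite rV_coord_consS.
  exact: measurableT_comp (measurable_rV_coord j) measurable_snd.
- rewrite (_ : _ \o _ = fst); first exact: measurable_fst.
  by apply/funext => p /=; rewrite rV_coord_cons0.
Qed.

HB.instance Definition _ n := @isMeasurableFun.Build _ _ _ _
  (@rV_cons n) (@measurable_rV_cons n).

Section lebesgue_cons.
Context (n : nat) (mu : {sigma_finite_measure set 'rV[R]_n -> \bar R}).

Definition lebesgue_cons : set 'rV[R]_n.+1 -> \bar R :=
  pushforward (@lebesgue_measure R \x mu)%E (@rV_cons n).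

Let lebesgue_cons0 : lebesgue_cons set0 = 0%E.
Proof. by apply: measure0; exact: measurable_rV_cons. Qed.

Let lebesgue_cons_ge0 A : (0 <= lebesgue_cons A)%E.
Proof. by apply: measure_ge0; exact: measurable_rV_cons. Qed.

Let lebesgue_cons_sigma_additive : semi_sigma_additive lebesgue_cons.
Proof.
by apply: measure_semi_sigma_additive; exact: measurable_rV_cons.
Qed.

HB.instance Definition _ := isMeasure.Build _ _ _ lebesgue_cons
  lebesgue_cons0 lebesgue_cons_ge0 lebesgue_cons_sigma_additive.

Let lebesgue_cons_sigma_finite : sigma_finite setT lebesgue_cons.
Proof.
have /sigma_finiteP[F [TF ndF Foo]] := sigma_finiteT (@lebesgue_measure R).
have /sigma_finiteP[G [TG ndG Goo]] := sigma_finiteT mu.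
pose head (x : 'rV[R]_n.+1) := rV_coord ord0 x.
pose tail (x : 'rV[R]_n.+1) : 'rV[R]_n := \row_i rV_coord (lift ord0 i) x.
have mhead : measurable_fun setT head by exact: measurable_rV_coord.
have mtail : measurable_fun setT tail.
  apply: measurable_to_rV => i.
  rewrite (_ : _ \o _ = @rV_coord R n.+1 (lift ord0 i)).
    exact: measurable_rV_coord.
  by apply/funext => x /=; rewrite {1}/rV_coord mxE.
have tailK p : tail (@rV_cons n p) = p.2.
  by apply/rowP => i; rewrite mxE rV_coord_consS.
exists (fun k => head @^-1` F k `&` tail @^-1` G k).
  apply/seteqP; split => // x _.
  have [k _ Fk] : (\bigcup_k F k) (head x) by rewrite -TF.
  have [l _ Gl] : (\bigcup_k G k) (tail x) by rewrite -TG.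
  exists (maxn k l) => //; split => /=.
    by move: (head x) Fk; exact/subsetPset/ndF/leq_maxl.
  by move: (tail x) Gl; exact/subsetPset/ndG/leq_maxr.
move=> k; have [mF Fk] := Foo k; have [mG Gk] := Goo k; split.
  apply: measurableI.
    by rewrite -[X in measurable X]setTI; exact: mhead.
  by rewrite -[X in measurable X]setTI; exact: mtail.
rewrite /lebesgue_cons /pushforward (_ : _ @^-1` _ = F k `*` G k).
  by rewrite product_measure1E// lte_mul_pinfty// ge0_fin_numE.
by apply/seteqP; split => p; rewrite /= /head rV_coord_cons0 tailK.
Qed.

HB.instance Definition _ := @Measure_isSigmaFinite.Build _ _ _
  lebesgue_cons lebesgue_cons_sigma_finite.

End lebesgue_cons.

(** The n-fold product of the Lebesgue measure of [R], on Borel sets. *)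
Fixpoint borel_lebesgue n : {sigma_finite_measure set 'rV[R]_n -> \bar R} :=
  match n with
  | 0 => [the {sigma_finite_measure set _ -> \bar R} of \d_(0 : 'rV[R]_0)]
  | m.+1 => [the {sigma_finite_measure set _ -> \bar R} of
              lebesgue_cons (borel_lebesgue m)]
  end.

End borel_lebesgue.

Section lebesgue.
Context (R : realType) (n : nat).

(** R^n with the sigma-algebra of Lebesgue-measurable sets *)
Definition rVL := caratheodory_type (borel_lebesgue R n)^*%mu.
HB.instance Definition _ := Measurable.on rVL.

Definition lebesgue : set rVL -> \bar R :=
  @completed_measure_extension _ _ _ (borel_lebesgue R n).
HB.instance Definition _ := Measure.on lebesgue.

Let lebesgue_sigma_finite : sigma_finite setT lebesgue.
Proof. exact/completed_measure_extension_sigma_finite/sigma_finiteT. Qed.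

HB.instance Definition _ :=
  @Measure_isSigmaFinite.Build _ _ _ lebesgue lebesgue_sigma_finite.

Lemma borel_measurable_rVL (A : set 'rV[R]_n) :
  measurable A -> measurable (A : set rVL).
Proof. by move=> mA; apply: sub_caratheodory; exact: sub_sigma_algebra. Qed.

End lebesgue.

Arguments lebesgue R n _ : clear implicits.

Section surface.
Context (R : realType) (n : nat).
Implicit Types x : 'rV[R]_n.

(** Euclidean norm; the library's norm on ['rV[R]_n] is the sup norm. *)
Definition enorm x : R := Num.sqrt (\sum_i x ord0 i ^+ 2).

Definition unit_sphere : set 'rV[R]_n := [set x | enorm x = 1].

Definition punctured_ball : set 'rV[R]_n := [set x | 0 < enorm x <= 1].

Lemma measurable_enorm : measurable_fun setT enorm.
Proof.
apply: (@measurableT_comp _ _ _ _ _ _ (@Num.sqrt R)).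
  apply: continuous_measurable_fun; exact: sqrt_continuous.
apply: measurable_sum => i; apply: measurable_funX.
exact: measurable_rV_coord.
Qed.

Lemma measurable_punctured_ball : measurable (punctured_ball : set (rVL R n)).
Proof.
apply: borel_measurable_rVL.
rewrite (_ : punctured_ball = enorm @^-1` `]0, 1]).
  by rewrite -[X in measurable X]setTI; apply: measurable_enorm.
by apply/seteqP; split => x /=; rewrite in_itv.
Qed.

Definition radial x : 'rV[R]_n := (enorm x)^-1 *: x.

(** R^n with the sigma-algebra of those [A] such that [radial @^-1` A] is
    Lebesgue measurable; on subsets of [unit_sphere] this is measurability for
    the (completed) surface measure. *)
Definition rVS := 'rV[R]_n.
HB.instance Definition _ := Pointed.on rVS.

Let radial_image : set (set rVS) :=
  image_set_system setT radial (measurable : set (set (rVL R n))).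

Let sigma_radial_image : sigma_algebra setT radial_image.
Proof. exact/sigma_algebra_image/sigma_algebra_measurable. Qed.

Let radial_image0 : radial_image set0.
Proof. by case: sigma_radial_image. Qed.

Let radial_imageC A : radial_image A -> radial_image (~` A).
Proof. by case: sigma_radial_image => _ + _ mA => /(_ _ mA); rewrite setTD. Qed.

Let radial_image_bigcup (F : (set rVS)^nat) :
  (forall i, radial_image (F i)) -> radial_image (\bigcup_i F i).
Proof. by case: sigma_radial_image => _ _; exact. Qed.

HB.instance Definition _ := @isMeasurable.Build default_measure_display
  rVS radial_image radial_image0 radial_imageC radial_image_bigcup.

Lemma measurable_radial : measurable_fun setT (radial : rVL R n -> rVS).
Proof. by move=> _ A mA. Qed.

(** Volume of the cone [{t x | x in A, 0 < t <= 1}] over the part of [A] in the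
    unit sphere *)
Definition cone_volume : set rVS -> \bar R :=
  pushforward (mrestr (lebesgue R n) measurable_punctured_ball)
    (radial : rVL R n -> rVS).

Let cone_volume0 : cone_volume set0 = 0%E.
Proof. by apply: measure0; exact: measurable_radial. Qed.

Let cone_volume_ge0 A : (0 <= cone_volume A)%E.
Proof. by apply: measure_ge0; exact: measurable_radial. Qed.

Let cone_volume_sigma_additive : semi_sigma_additive cone_volume.
Proof.
by apply: measure_semi_sigma_additive; exact: measurable_radial.
Qed.

HB.instance Definition _ := isMeasure.Build _ _ _ cone_volume
  cone_volume0 cone_volume_ge0 cone_volume_sigma_additive.

(** Surface measure of the unit sphere, as a measure on R^n that is
    concentrated on the sphere *)
Definition surface : set rVS -> \bar R := mscale (n%:R%:nng) cone_volume.
HB.instance Definition _ := Measure.on surface.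

End surface.

Arguments unit_sphere R n _ : clear implicits.
Arguments surface R n _ : clear implicits.

(** Integration against a charge, through its Jordan decomposition *)
Section charge_integral.
Context d (T : measurableType d) (R : realType).
Variable nu : {charge set T -> \bar R}.

Definition hahn_pos : set T := sval (cid (Hahn_decomposition nu)).
Definition hahn_neg : set T :=
  sval (cid (svalP (cid (Hahn_decomposition nu)))).

Lemma hahn_posneg : hahn_decomposition nu hahn_pos hahn_neg.
Proof. exact: svalP (cid (svalP (cid (Hahn_decomposition nu)))). Qed.

(** The measure |nu|. A library charge takes finite values, so it is a signed
    measure with [|nu| T < +oo]. *)
Definition charge_total_variation : set T -> \bar R := charge_variation hahn_posneg.

Definition charge_integral (f : T -> \bar R) : \bar R :=
  (\int[jordan_pos hahn_posneg]_x f x - \int[jordan_neg hahn_posneg]_x f x)%E.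

End charge_integral.

Section dini.
Context (R : realType) (n : nat).

Definition rotation (rho : 'M[R]_n) : Prop :=
  rho *m rho^T = 1%:M /\ \det rho = 1.

(** Vectors are rows, so [rho] acts by right multiplication. *)
Definition rotation_norm (rho : 'M[R]_n) : \bar R :=
  ereal_sup [set (enorm (x *m rho - x))%:E | x in unit_sphere R n].

Definition omega1 (Omega : 'rV[R]_n -> R) (delta : R) : \bar R :=
  ereal_sup [set (\int[surface R n]_(theta in unit_sphere R n)
                   `|Omega (theta *m rho) - Omega theta|%:E)%E
            | rho in [set rho | rotation rho /\
                                (rotation_norm rho <= delta%:E)%E]].

(** [s] may be [+oo]. [Omega] is a total function, of which only the values
    outside the origin matter; membership in [Lfun] concerns [Omega] on the unit
    sphere, where [surface] is concentrated. *)
Definition dini (s : \bar R) (alpha : R) (Omega : 'rV[R]_n -> R) : Prop :=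
  Omega \in Lfun (surface R n) s /\
  (\int[lebesgue_measure]_(delta in `]0%R, 1%R[)
     (omega1 Omega delta * ((delta `^ (1 + alpha))^-1)%:E) < +oo)%E.

End dini.

(** For [y = x] the integrand is [0], since [0 `^ a = 0] for [a != 0] and
    [0^-1 = 0]. *)
Definition fractional_integral (R : realType) (n : nat)
    (Omega : 'rV[R]_n -> R) (alpha : R)
    (nu : {charge set (rVL R n) -> \bar R}) (x : 'rV[R]_n) : \bar R :=
  charge_integral nu (fun y : 'rV[R]_n =>
    (Omega (x - y) / enorm (x - y) `^ (n%:R - alpha))%:E).

(* Main.v *)
From HB Require Import structures.
Require Import Defs.
From mathcomp Require Import all_boot all_order all_algebra finmap.
From mathcomp Require Import all_classical all_reals all_analysis.
From mathcomp Require Import measurable_realfun ring lra.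

Set Implicit Arguments.
Unset Strict Implicit.
Unset Printing Implicit Defensive.

Import Order.TTheory GRing.Theory Num.Theory.
Import numFieldNormedType.Exports.

Local Open Scope classical_set_scope.
Local Open Scope ring_scope.

(** Let [K x = Omega x / |x|^(n - alpha)], a kernel that is homogeneous of degree
    [- (n - alpha)], and let [c = nu (R^n)]. Homogeneity gives exactly
    [m {|c K| > lambda} = lambda^-r * |c|^r * ||Omega||_r^r / n], so it suffices
    that [lambda^r * m {|T nu - c K| > eta lambda} -> 0] for every [eta > 0].
    Split [K] at height [d lambda] with [d] small: the part below contributes at
    most [2 d lambda |nu| (R^n)] to [|T nu - c K|]. The part above is, up to the
    dilation by [e = lambda^(1/(n - alpha))], a fixed function [k], which is
    integrable because [r > 1]; after the dilation its contribution is the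
    integral of [|k (z - e y) - k z|] against [|nu|] in [y], which tends to [0]
    in [L^1 (dz)] by Tonelli, the [L^1]-continuity of translations and dominated
    convergence. *)

(** * Affine changes of variables *)

(** Measurability is the obstacle behind the appeal to Tonelli: [k] is only Lebesgue measurable, so
    [k (z - e y)] need not be measurable in [(z, y)] for the product sigma-algebra. Hence [k] is
    replaced by a Borel function that agrees with it off a Borel null set [N]. For fixed [z], the
    [y] with [z - e y] in [N] form a null set, which [|nu|] does not charge; this is how absolute
    continuity is used. The level sets of [T nu], in contrast, never have to be measurable:
    [lebesgue] is an outer measure, so inclusions and subadditivity suffice. The dilation costs
    nothing: pulling a set back along [x |-> e x] multiplies its volume by [e^-n], and
    [e^n = lambda^r] because [n / (n - alpha) = r]. The weight [lambda^r] thus cancels the Jacobian,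
    and one fixed truncated kernel serves for all [lambda]. Comparing [T nu] with [c K] up to
    [eta lambda] is enough, because changing the threshold [lambda] by a factor close to 1 changes
    the exact distribution of [c K] by a factor close to 1. *)

Section affine_line.
Context (R : realType).
Variables (a b : R).

Definition line_aff (x : measurableTypeR R) : measurableTypeR R := a * x + b.

Lemma measurable_line_aff : measurable_fun setT line_aff.
Proof. by apply: measurable_funD => //; exact: measurable_funM. Qed.

HB.instance Definition _ := @isMeasurableFun.Build _ _ _ _
  line_aff measurable_line_aff.

(** By uniqueness of Lebesgue measure: [|a|] times the image measure agrees with it on the intervals
    []u, v]]. For [a < 0] the preimage of such an interval is closed on the left instead of the
    right, with the same length. *)
Lemma lebesgue_measure_line_aff (A : set R) : a != 0 -> measurable A ->
  (lebesgue_measure (line_aff @^-1` A) = `|a|^-1%:E * lebesgue_measure A)%E.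
Proof.
move=> a0 mA.
have na0 : 0 <= `|a| by [].
pose m : {measure set (measurableTypeR R) -> \bar R} :=
  mscale (NngNum na0) (pushforward (@lebesgue_measure R) line_aff).
have -> : lebesgue_measure A = m measurable_line_aff A.
  apply: lebesgue_measure_unique => // _ [[u v]] _ <-.
  change (lebesgue_measure `]u, v]%classic = 
    `|a|%:E * lebesgue_measure (line_aff @^-1` `]u, v]%classic))%E.
  have [a_gt0|a_lt0|/eqP] := ltrgtP a 0; last by rewrite (negbTE a0).
    rewrite (_ : line_aff @^-1` _ = `[(v - b) / a, (u - b) / a[%classic).
      rewrite !lebesgue_measure_itv/= !lte_fin ltr_nM2r ?invr_lt0//.
      rewrite ltrD2r; case: ifPn => // _; last by rewrite mule0.
      by rewrite -EFinD -EFinM ltr0_norm//; congr EFin; field.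
    apply/seteqP; split => x /=; rewrite /line_aff !in_itv/= => /andP[h1 h2].
      by rewrite ler_ndivrMr// ltr_ndivlMr//; apply/andP; split; lra.
    by move: h1 h2; rewrite ler_ndivrMr// ltr_ndivlMr// => h1 h2; apply/andP; split; lra.
  rewrite (_ : line_aff @^-1` _ = `](u - b) / a, (v - b) / a]%classic).
    rewrite !lebesgue_measure_itv/= !lte_fin ltr_pM2r ?invr_gt0//.
    rewrite ltrD2r; case: ifPn => // _; last by rewrite mule0.
    by rewrite -EFinD -EFinM gtr0_norm//; congr EFin; field.
  apply/seteqP; split => x /=; rewrite /line_aff !in_itv/= => /andP[h1 h2].
    by rewrite ler_pdivlMr// ltr_pdivrMr//; apply/andP; split; lra.
  by move: h1 h2; rewrite ler_pdivlMr// ltr_pdivrMr// => h1 h2; apply/andP; split; lra.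
by rewrite /m/= /mscale/= muleA -EFinM mulVf ?normr_eq0// mul1e.
Qed.

Lemma ge0_integral_line_aff (f : R -> \bar R) : a != 0 ->
  measurable_fun setT f -> (forall x, 0 <= f x)%E ->
  (\int[lebesgue_measure]_x f (line_aff x) =
   `|a|^-1%:E * \int[lebesgue_measure]_x f x)%E.
Proof.
move=> a0 mf f0.
have nV : 0 <= `|a|^-1 by rewrite invr_ge0.
transitivity (\int[pushforward (@lebesgue_measure R) line_aff]_x f x)%E.
  by rewrite ge0_integral_pushforward.
rewrite -[RHS](ge0_integral_mscale _ _ (NngNum nV))//.
apply: eq_measure_integral => A mA _.
exact: lebesgue_measure_line_aff.
Qed.

End affine_line.

Section affine_space.
Context (R : realType).

Lemma rV_consP n (x : 'rV[R]_n.+1) :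
  x = rV_cons (x ord0 ord0, \row_j x ord0 (lift ord0 j)).
Proof.
apply/rowP => i; case: (unliftP ord0 i) => [j|] ->.
  by have := rV_coord_consS (x ord0 ord0, \row_j x ord0 (lift ord0 j)) j;
    rewrite /rV_coord/= => ->; rewrite mxE.
by have := rV_coord_cons0 (x ord0 ord0, \row_j x ord0 (lift ord0 j));
    rewrite /rV_coord/= => ->.
Qed.

Lemma rV_cons_aff n (a : R) (p q : R * 'rV[R]_n) :
  a *: rV_cons p + rV_cons q = rV_cons (a * p.1 + q.1, a *: p.2 + q.2).
Proof.
have coordE m (i : 'I_m) (x y : 'rV[R]_m) :
  rV_coord i (a *: x + y) = a * rV_coord i x + rV_coord i y.
  by rewrite /rV_coord !mxE.
apply/rowP => i; change (rV_coord i (a *: rV_cons p + rV_cons q) =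
  rV_coord i (rV_cons (a * p.1 + q.1, a *: p.2 + q.2))); rewrite coordE.
case: (unliftP ord0 i) => [j|] ->.
  by rewrite !rV_coord_consS coordE.
by rewrite !rV_coord_cons0.
Qed.

Definition rV_aff n (a : R) (b x : 'rV[R]_n) : 'rV[R]_n := a *: x + b.

Lemma measurable_rV_aff n (a : R) (b : 'rV[R]_n) :
  measurable_fun setT (rV_aff a b).
Proof.
apply: measurable_to_rV => i.
rewrite (_ : _ \o _ = fun x => a * rV_coord i x + b ord0 i); last first.
  by apply/funext => x; rewrite /= /rV_coord !mxE.
apply: measurable_funD => //; apply: measurable_funM => //.
exact: measurable_rV_coord.
Qed.

(** Induction on the dimension. The measure in dimension [n.+1] integrates the measures of sections
    over the line; each section contributes [|a|^-n] and the change of variable on the line one more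
    [|a|^-1]. *)
Lemma borel_lebesgue_aff n (a : R) (b : 'rV[R]_n) (A : set 'rV[R]_n) :
  a != 0 -> measurable A ->
  (borel_lebesgue R n (rV_aff a b @^-1` A) =
    (`|a| ^- n)%:E * borel_lebesgue R n A)%E.
Proof.
move=> a0; elim: n b A => [|n IH] b A mA.
  rewrite expr0 invr1 mul1e; congr (_ _).
  by apply/seteqP; split => x; rewrite /preimage /= (thinmx0 x) (thinmx0 (rV_aff _ _ _)).
pose B := @rV_cons R n @^-1` A.
have mB : measurable B.
  by rewrite -[B]setTI; exact: measurable_rV_cons.
pose h x := borel_lebesgue R n (xsection B x).
have mh : measurable_fun setT h by exact: measurable_fun_xsection.
pose b' : 'rV[R]_n := \row_j b ord0 (lift ord0 j).
transitivity (\int[lebesgue_measure]_x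
    ((`|a| ^- n)%:E * h (line_aff a (b ord0 ord0) x)))%E.
  apply: eq_integral => x _.
  rewrite -(IH b'); last exact: measurable_xsection.
  have E z : rV_aff a b (rV_cons (x, z)) =
      rV_cons (line_aff a (b ord0 ord0) x, rV_aff a b' z).
    by rewrite /rV_aff {1}[b]rV_consP rV_cons_aff.
  congr (borel_lebesgue R n _); apply/seteqP.
  by split => z; rewrite /xsection/= !inE /B/= E.
rewrite ge0_integralZl//.
- by rewrite ge0_integral_line_aff// muleA -EFinM exprS invfM mulrC.
- by apply: measurableT_comp => //; exact: measurable_line_aff.
Qed.

(** [lebesgue] is by construction the outer measure, so this and subadditivity hold for arbitrary
    sets. *)
Lemma le_lebesgue n (A B : set 'rV[R]_n) :
  A `<=` B -> (lebesgue R n A <= lebesgue R n B)%E.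
Proof. exact: le_mu_ext. Qed.

Lemma lebesgueU_le n (A B : set 'rV[R]_n) :
  (lebesgue R n (A `|` B) <= lebesgue R n A + lebesgue R n B)%E.
Proof. exact: (outer_measureU2 (borel_lebesgue R n)^*%mu). Qed.

Lemma lebesgue_borelE n (A : set 'rV[R]_n) : measurable A ->
  lebesgue R n A = borel_lebesgue R n A.
Proof. exact: measurable_mu_extE. Qed.

Lemma rV_affK n (a : R) (b : 'rV[R]_n) : a != 0 ->
  cancel (rV_aff a b) (rV_aff a^-1 (- (a^-1 *: b))).
Proof.
move=> a0 x; rewrite /rV_aff scalerDr scalerA mulVf// scale1r.
by rewrite addrK.
Qed.

Lemma rV_affVK n (a : R) (b : 'rV[R]_n) : a != 0 ->
  cancel (rV_aff a^-1 (- (a^-1 *: b))) (rV_aff a b).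
Proof.
move=> a0 x; rewrite /rV_aff scalerBr !scalerA divff// !scale1r.
by rewrite subrK.
Qed.

(** Borel covers pull back to Borel covers, which gives one inequality ([upper]) for every
    invertible affine map; the same inequality for the inverse map is the converse. *)
Lemma lebesgue_aff n (a : R) (b : 'rV[R]_n) (A : set 'rV[R]_n) : a != 0 ->
  (lebesgue R n (rV_aff a b @^-1` A) = (`|a| ^- n)%:E * lebesgue R n A)%E.
Proof.
have upper (c : R) (d : 'rV[R]_n) (X : set 'rV[R]_n) : c != 0 ->
    ((`|c| ^+ n)%:E * lebesgue R n (rV_aff c d @^-1` X) <= lebesgue R n X)%E.
  move=> c0; have cn : (0 < `|c| ^+ n) by rewrite exprn_gt0// normr_gt0.
  apply: le_ereal_inf_tmp => _ [F [mF XF] <-].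
  have -> : (\sum_(k <oo) borel_lebesgue R n (F k) = (`|c| ^+ n)%:E *
      \sum_(k <oo) borel_lebesgue R n (rV_aff c d @^-1` F k))%E.
    rewrite -nneseriesZl//; apply: eq_eseriesr => k _.
    by rewrite borel_lebesgue_aff// muleA -EFinM divff ?gt_eqF// mul1e.
  rewrite lee_pmul2l ?lte_fin//; apply: ereal_inf_lbound.
  exists (fun k => rV_aff c d @^-1` F k) => //; split.
    by move=> k; rewrite -[X in measurable X]setTI; exact: measurable_rV_aff.
  by move=> x /XF [k _ Fk]; exists k.
move=> a0; have an : (0 < `|a| ^+ n) by rewrite exprn_gt0// normr_gt0.
apply/eqP; rewrite eq_le; apply/andP; split.
  by rewrite muleC lee_pdivlMr// muleC; exact: upper.
have := upper a^-1 (- (a^-1 *: b)) (rV_aff a b @^-1` A).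
rewrite invr_eq0 => /(_ a0); rewrite normfV exprVn; apply: le_trans.
rewrite lee_pmul2l// ?lte_fin ?invr_gt0//; apply: le_lebesgue => x Ax /=.
by rewrite rV_affVK.
Qed.

Lemma measurable_rV_aff_lebesgue n (a : R) (b : 'rV[R]_n) : a != 0 ->
  measurable_fun setT (rV_aff a b : rVL R n -> rVL R n).
Proof.
move=> a0 _ A mA; rewrite setTI.
have an : (0 < `|a| ^+ n) by rewrite exprn_gt0// normr_gt0.
(* By bijectivity every test set of the Caratheodory criterion is a preimage; the criterion for [A]
   tested on [Y] is then merely rescaled. *)
move=> X; have [Y ->] : exists Y, X = rV_aff a b @^-1` Y.
  exists (rV_aff a^-1 (- (a^-1 *: b)) @^-1` X).
  by apply/seteqP; split => x /=; rewrite rV_affK.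
change (lebesgue R n (rV_aff a b @^-1` Y) =
  lebesgue R n (rV_aff a b @^-1` (Y `&` A)) +
  lebesgue R n (rV_aff a b @^-1` (Y `&` ~` A)))%E.
rewrite !lebesgue_aff// -ge0_muleDr ?mu_ext_ge0//; congr (_ * _)%E; exact: mA.
Qed.

End affine_space.

(** * Borel versions of Lebesgue-measurable functions *)

Section borel_version.
Context (R : realType) (n : nat).
Local Notation mu := (borel_lebesgue R n).

Lemma measurable_hull (A : set 'rV[R]_n) : (lebesgue R n A < +oo)%E ->
  exists2 F : set 'rV[R]_n, measurable F &
    A `<=` F /\ lebesgue R n F = lebesgue R n A.
Proof.
move=> Aoo; have Afin : lebesgue R n A \is a fin_num.
  by rewrite ge0_fin_numE//; exact: mu_ext_ge0.
have cover k : exists E, measurable_cover A E /\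
    (\sum_(j <oo) mu (E j) < lebesgue R n A + (k.+1%:R^-1)%:E)%E.
  have := @lb_ereal_inf_adherent R _ (k.+1%:R^-1) _ Afin.
  by case=> // _ [E AE <-] ?; exists E.
have {cover}[E AE] := choice cover.
have mE k j : measurable (E k j) by have [[]] := AE k.
have AF : A `<=` \bigcap_k \bigcup_j E k j.
  by move=> x Ax k _; have [[_ cov] _] := AE k; exact: cov.
exists (\bigcap_k \bigcup_j E k j).
  by apply: bigcapT_measurable => k; apply: bigcupT_measurable => j.
split => //; apply/eqP; rewrite eq_le; apply/andP; split; last exact: le_lebesgue.
apply/lee_addgt0Pr => e e0.
have [k ke] : exists k, k.+1%:R^-1 < e.
  by have [k _ /(_ k (leqnn k))] := near_infty_natSinv_lt (PosNum e0); exists k.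
have [_ /ltW sE] := AE k.
apply: (@le_trans _ _ (lebesgue R n A + (k.+1%:R^-1)%:E)%E); last first.
  by rewrite leeD2l// lee_fin ltW.
apply: le_trans sE; apply: ereal_inf_lbound; exists (E k) => //; split => //.
by move=> x /(_ k I).
Qed.

Lemma null_hull (A : set 'rV[R]_n) : lebesgue R n A = 0%E ->
  exists2 F : set 'rV[R]_n, measurable F & A `<=` F /\ mu F = 0%E.
Proof.
move=> A0; have [|F mF [AF FA]] := @measurable_hull A; first by rewrite A0.
by exists F => //; split => //; rewrite -lebesgue_borelE// FA.
Qed.

(** On each piece [S k] of finite measure, [A] has a Borel hull of the same measure; the difference
    is null and has itself a Borel null hull. The countable unions of these hulls are [B] and
    [N]. *)
Lemma borel_mod_null (A : set 'rV[R]_n) : measurable (A : set (rVL R n)) ->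
  exists B N : set 'rV[R]_n, [/\ measurable B, measurable N, mu N = 0%E &
    A `\` N = B `\` N].
Proof.
move=> mA; have /sigma_finiteP[S [TS _ Soo]] := sigma_finiteT mu.
have mS k : measurable (S k) by have [] := Soo k.
have mAS k : measurable (A `&` S k : set (rVL R n)).
  by apply: measurableI => //; exact: borel_measurable_rVL.
have hull k : exists FN : set 'rV[R]_n * set 'rV[R]_n,
    [/\ measurable FN.1, measurable FN.2, mu FN.2 = 0%E &
     A `&` S k `<=` FN.1 /\ FN.1 `\` (A `&` S k) `<=` FN.2].
  have ASoo : (lebesgue R n (A `&` S k) < +oo)%E.
    have [_] := Soo k; apply: le_lt_trans.
    apply: (@le_trans _ _ (lebesgue R n (S k))); last by rewrite lebesgue_borelE.
    by apply: le_lebesgue => x [].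
  have [F mF [AF FA]] := measurable_hull ASoo.
  have mFL : measurable (F : set (rVL R n)) by exact: borel_measurable_rVL.
  have D0 : lebesgue R n (F `\` (A `&` S k)) = 0%E.
    have FAS : F `&` (A `&` S k) = A `&` S k by exact: setIidr.
    have := @measureD _ _ _ (lebesgue R n) _ _ mFL (mAS k).
    rewrite FAS; move=> ->; last by change (lebesgue R n F < +oo)%E; rewrite FA.
    change (lebesgue R n F - lebesgue R n (A `&` S k) = 0)%E.
    by rewrite FA subee// ge0_fin_numE//; exact: mu_ext_ge0.
  by have [N mN [DN N0]] := null_hull D0; exists (F, N).
have {hull}[FN hFN] := choice hull.
exists (\bigcup_k (FN k).1), (\bigcup_k (FN k).2); split.
- by apply: bigcupT_measurable => k; have [] := hFN k.
- by apply: bigcupT_measurable => k; have [] := hFN k.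
- apply: measure_negligible; first by apply: bigcupT_measurable => k; have [] := hFN k.
  apply: negligible_bigcup => k; have [_ mN N0 _] := hFN k.
  exact/negligibleP.
- apply/seteqP; split => x [Xx Nx]; split => //.
    have [k _ Sx] : (\bigcup_k S k) x by rewrite -TS.
    by exists k => //; have [_ _ _ [+ _]] := hFN k; apply.
  case: Xx => k _ Fx; apply: contrapT => nA; apply: Nx; exists k => //.
  by have [_ _ _ [_]] := hFN k; apply; split => // -[].
Qed.

(** Only the superlevel sets at rational heights are made Borel, so that countably many null sets
    are discarded. *)
Lemma borel_version (f : 'rV[R]_n -> R) :
  measurable_fun setT (f : rVL R n -> R) ->
  exists N : set 'rV[R]_n, [/\ measurable N, mu N = 0%E &
    measurable_fun setT (f \_ (~` N))].
Proof.
move=> mf.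
have sub (q : rat) : exists BN : set 'rV[R]_n * set 'rV[R]_n,
    [/\ measurable BN.1, measurable BN.2, mu BN.2 = 0%E &
     f @^-1` `]ratr q, +oo[ `\` BN.2 = BN.1 `\` BN.2].
  have mq : measurable (f @^-1` `]ratr q, +oo[%classic : set (rVL R n)).
    rewrite -[X in measurable X]setTI; exact: mf.
  by have [B [N [? ? ? ?]]] := borel_mod_null mq; exists (B, N).
have {sub}[BN hBN] := choice sub.
pose N := \bigcup_q (BN q).2.
have mN : measurable N.
  by apply: bigcupT_measurable_rat => q; have [] := hBN q.
exists N; split => //.
  apply: measure_negligible => //.
  rewrite /N (_ : \bigcup_q _ = \bigcup_k (if choice.unpickle k is Some q then (BN q).2 else set0)).
    apply: negligible_bigcup => k; case: choice.unpickle => [q|]; last exact: negligible_set0.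
    by have [_ mNq N0 _] := hBN q; apply/negligibleP.
  apply/seteqP; split => x.
    by move=> [q _ Nx]; exists (choice.pickle q); [by []|rewrite choice.pickleK].
  by move=> [k _]; case: choice.unpickle => // q Nx; exists q.
apply/(measurable_restrictT _ (measurableC mN)).
move=> mC; apply: (measurability _ (RGenOInfty.measurableE R)) => //.
move=> /= _ [_ [x ->] <-].
(* Off [N], the set where [f > x] is the union over rationals [q >= x] of the sets where [f > q],
   each of which is Borel there. *)
rewrite (_ : _ `&` _ = \bigcup_q (if x <= ratr q then (BN q).1 `\` N else set0)).
  apply: bigcupT_measurable_rat => q; case: ifP => // _.
  by apply: measurableD => //; have [] := hBN q.
have Nq q y : ~ N y -> f y > ratr q <-> (BN q).1 y.
  move=> Ny; have [_ _ _ /seteqP[h1 h2]] := hBN q.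
  have Nqy : ~ (BN q).2 y by move=> ?; apply: Ny; exists q.
  split => h.
    by have /h1[] : (f @^-1` `]ratr q, +oo[ `\` (BN q).2) y
      by split => //=; rewrite in_itv/= h.
  have /h2[] : ((BN q).1 `\` (BN q).2) y by [].
  by rewrite /= in_itv/= andbT.
apply/seteqP; split => y.
  move=> [Ny] /=; rewrite in_itv/= andbT => xf.
  have [q] := rat_in_itvoo xf; rewrite in_itv/= => /andP[xq qf].
  by exists q => //; rewrite (ltW xq); split => //; apply/Nq.
move=> [q _]; case: ifPn => // xq [/= Bq Ny]; split => //=.
by rewrite in_itv/= andbT (le_lt_trans xq)//; apply/Nq.
Qed.

End borel_version.

(** * Continuity of translations in L^1 *)

Section box.
Context (R : realType).
Local Notation mu := (borel_lebesgue R).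

Definition box n (N : nat) : set 'rV[R]_n := [set x | forall i, `|x ord0 i| <= N%:R].

Lemma measurable_box n N : measurable (@box n N).
Proof.
rewrite (_ : box N = \bigcap_(i in [set: 'I_n]) (@rV_coord R n i @^-1` [set y | `|y| <= N%:R])).
  apply: fin_bigcap_measurable => // i _.
  rewrite -[X in measurable X]setTI; apply: measurable_rV_coord => //.
  rewrite (_ : [set y | _] = `[- N%:R, N%:R]%classic)//.
  by apply/seteqP; split => y /=; rewrite in_itv/= ler_norml.
by apply/seteqP; split => x xN i; [move=> _; exact: xN|exact: xN].
Qed.

Lemma borel_lebesgueX n (A : set R) (B : set 'rV[R]_n) (C : set 'rV[R]_n.+1) :
  measurable A -> measurable B -> @rV_cons R n @^-1` C = A `*` B ->
  (mu n.+1 C = lebesgue_measure A * mu n B)%E.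
Proof.
move=> mA mB CAB; rewrite -product_measure1E// -CAB.
by [].
Qed.

Lemma borel_lebesgue_box n N : (mu n (box N) < +oo)%E.
Proof.
elim: n => [|n IH]; first by rewrite /= diracE; case: (_ \in _); rewrite ltry.
rewrite (@borel_lebesgueX _ `[- N%:R, N%:R]%classic (box N))//; last 2 first.
- exact: measurable_box.
- apply/seteqP; split => -[x z] /=.
    move=> xz; split; last first.
      move=> i; have := xz (lift ord0 i).
      by have := @rV_coord_consS R n (x, z) i; rewrite /rV_coord/= => ->.
    have := xz ord0; have := @rV_coord_cons0 R n (x, z).
    by rewrite /rV_coord/= => ->; rewrite in_itv/= ler_norml.
  move=> [+ zN] i; rewrite in_itv/= -ler_norml.
  case: (unliftP ord0 i) => [j|] ->.
    have := @rV_coord_consS R n (x, z) j; rewrite /rV_coord/= => -> _; exact: zN.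
  by have := @rV_coord_cons0 R n (x, z); rewrite /rV_coord/= => ->.
apply: lte_mul_pinfty => //; rewrite lebesgue_measure_itv/=.
by case: ifP.
Qed.

Lemma borel_lebesgue_hyperplane n (i : 'I_n) (a : R) :
  mu n (rV_coord i @^-1` [set a]) = 0%E.
Proof.
elim: n i => [[//]|n IH i]; case: (unliftP ord0 i) => [j|] ->.
  rewrite (@borel_lebesgueX _ setT (rV_coord j @^-1` [set a]))//.
  - by rewrite IH mule0.
  - by rewrite -[X in measurable X]setTI; exact: measurable_rV_coord.
  - by apply/seteqP; split => -[x z]; rewrite /= rV_coord_consS => // -[].
rewrite (@borel_lebesgueX _ [set a] setT)//.
  by rewrite lebesgue_measure_set1 mul0e.
by apply/seteqP; split => -[x z]; rewrite /= rV_coord_cons0 => // -[].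
Qed.

End box.

(** * Extended-real sequences that become arbitrarily small *)

Section small_sequence.
Context (R : realType).

(** For nonnegative sequences this is convergence to 0, see [small_cvg]. The one-sided form
    tolerates infinite terms and is stable under domination. *)
Definition small (u : nat -> \bar R) :=
  forall e : R, 0 < e -> \forall j \near \oo, (u j <= e%:E)%E.

Lemma small_le (u v : nat -> \bar R) :
  (\forall j \near \oo, (u j <= v j)%E) -> small v -> small u.
Proof.
move=> uv sv e e0; near=> j; apply: (@le_trans _ _ (v j)); near: j => //.
exact: sv.
Unshelve. all: by end_near. Qed.

Lemma smallD (u v : nat -> \bar R) :
  small u -> small v -> small (fun j => u j + v j)%E.
Proof.
move=> su sv e e0; have e2 : 0 < e / 2 by rewrite divr_gt0.
near=> j; rewrite (splitr e) EFinD; apply: leeD; near: j; [exact: su|exact: sv].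
Unshelve. all: by end_near. Qed.

Lemma small_approx (u : nat -> \bar R) :
  (forall e : R, 0 < e -> exists2 v, small v &
     \forall j \near \oo, (u j <= v j + e%:E)%E) -> small u.
Proof.
move=> uP e e0; have e2 : 0 < e / 2 by rewrite divr_gt0.
have [v sv uv] := uP _ e2.
near=> j; apply: (@le_trans _ _ (v j + (e / 2)%:E)%E); first by near: j.
rewrite [X in (_ <= X%:E)%E](splitr e) EFinD leeD2r//; near: j; exact: sv.
Unshelve. all: by end_near. Qed.

Lemma small_cst0 : small (fun=> 0%E).
Proof. by move=> e e0; apply: nearW => j; rewrite lee_fin ltW. Qed.

Lemma smallZ (c : R) (u : nat -> \bar R) : 0 <= c ->
  small u -> small (fun j => c%:E * u j)%E.
Proof.
rewrite le_eqVlt => /predU1P[<- _|c0 su e e0].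
  by apply: small_le small_cst0; apply: nearW => j; rewrite mul0e.
have ec : 0 < e / c by rewrite divr_gt0.
have := su _ ec; apply: filterS => j; rewrite -(@lee_pmul2l _ c%:E)//.
by rewrite -EFinM mulrCA divff ?mulr1// gt_eqF.
Qed.

Lemma small_cvg (u : nat -> \bar R) :
  (forall j, (0 <= u j)%E) -> small u <-> u @ \oo --> 0%E.
Proof.
move=> u0; split => [su|u_0].
  have ufin : \forall j \near \oo, u j \is a fin_num.
    near=> j; rewrite ge0_fin_numE// (@le_lt_trans _ _ 1%:E)// ?ltry//.
    by near: j; exact: su.
  apply/fine_cvgP; split => //.
  apply/cvgrPdist_le => e e0; near=> j; rewrite sub0r normrN /= ger0_norm ?fine_ge0//.
  have fj : u j \is a fin_num by near: j.
  by rewrite -lee_fin fineK//; near: j; exact: su.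
move=> e e0; move/fine_cvgP : u_0 => [ufin /cvgrPdist_le/(_ e e0) ue].
near=> j; have fj : u j \is a fin_num by near: j.
rewrite -(fineK fj) lee_fin; have : `|0 - (fine \o u) j| <= e by near: j.
by rewrite sub0r normrN /= ger0_norm// fine_ge0.
Unshelve. all: by end_near. Qed.

End small_sequence.

(** * Translations of sets *)

Section translation.
Context (R : realType) (n : nat).
Local Notation mu := (borel_lebesgue R n).
Local Notation V := 'rV[R]_n.

Definition shift (h : V) (A : set V) : set V := [set z | A (z + h)].

Lemma measurable_shift h A : measurable A -> measurable (shift h A).
Proof.
move=> mA; rewrite (_ : shift h A = rV_aff 1 h @^-1` A).
  by rewrite -[X in measurable X]setTI; exact: measurable_rV_aff.
by apply/seteqP; split => z; rewrite /shift/= /rV_aff scale1r.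
Qed.

Lemma borel_lebesgue_shift h A : measurable A -> mu (shift h A) = mu A.
Proof.
move=> mA; rewrite (_ : shift h A = rV_aff 1 h @^-1` A).
  by rewrite borel_lebesgue_aff// ?oner_neq0// normr1 expr1n invr1 mul1e.
by apply/seteqP; split => z; rewrite /shift/= /rV_aff scale1r.
Qed.

(** The symmetric difference of [A] and its translate by [- h]: its measure is the L^1 distance
    between their indicators. *)
Definition moved (h : V) (A : set V) := (A `\` shift h A) `|` (shift h A `\` A).

Lemma measurable_moved h A : measurable A -> measurable (moved h A).
Proof.
move=> mA; have mS := measurable_shift h mA.
by apply: measurableU; exact: measurableD.
Qed.

Lemma movedC h A : moved h (~` A) = moved h A.
Proof.
by apply/seteqP; split => z; rewrite /moved/shift/=; case: (pselect (A z));
  case: (pselect (A (z + h))); tauto.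
Qed.

Lemma movedU h A B : moved h (A `|` B) `<=` moved h A `|` moved h B.
Proof.
move=> z; rewrite /moved/shift/=; tauto.
Qed.

Lemma moved_sub h A B : B `<=` A ->
  moved h A `<=` moved h B `|` (A `\` B) `|` shift h (A `\` B).
Proof.
move=> BA z; have := BA z; have := BA (z + h); rewrite /moved/shift/=.
by case: (pselect (B z)); case: (pselect (B (z + h))); tauto.
Qed.

(** Replacing [A] by [B] can alter membership of [z] or of [z + h], whence the two copies of
    [mu (A \ B)], the second one by translation invariance. *)
Lemma moved_le A B h : B `<=` A -> measurable A -> measurable B ->
  (mu (moved h A) <= mu (moved h B) + (mu (A `\` B) + mu (A `\` B)))%E.
Proof.
move=> BA mA mB; have mAB : measurable (A `\` B) by exact: measurableD.
have mm := measurable_moved h mB; have ms := measurable_shift h mAB.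
rewrite -[X in (_ + (_ + X))%E](borel_lebesgue_shift h mAB) addeA.
apply: (@le_trans _ _ (mu (moved h B `|` (A `\` B) `|` shift h (A `\` B)))).
  apply: le_measure; rewrite ?inE; [exact: measurable_moved| |exact: moved_sub].
  by apply: measurableU => //; exact: measurableU.
apply: (@le_trans _ _ (mu (moved h B `|` (A `\` B)) + mu (shift h (A `\` B)))%E).
  by apply: measureU2 => //; exact: measurableU.
by apply: leeD2r; exact: measureU2.
Qed.

Context (h : nat -> V)
  (h0 : forall e : R, 0 < e -> \forall j \near \oo, forall i, `|h j ord0 i| <= e).

(* Local-in-measure continuity of the indicator of [A] along the translations
   [h j]. Such sets form a sigma-algebra that contains the half-spaces, hence
   they are all the Borel sets. *)
Definition continuous_set (A : set V) :=
  measurable A /\ forall N, small (fun j => mu (box N `&` moved (h j) A)).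

Lemma continuous_setC A : continuous_set A -> continuous_set (~` A).
Proof.
move=> [mA sA]; split; first exact: measurableC.
by move=> N; under eq_fun do rewrite movedC; exact: sA.
Qed.

Lemma continuous_setU A B :
  continuous_set A -> continuous_set B -> continuous_set (A `|` B).
Proof.
move=> [mA sA] [mB sB]; split; first exact: measurableU.
move=> N; apply: small_le (smallD (sA N) (sB N)); apply: nearW => j.
have mbN := @measurable_box R n N.
have mmA := measurable_moved (h j) mA; have mmB := measurable_moved (h j) mB.
apply: (@le_trans _ _ (mu ((box N `&` moved (h j) A) `|` (box N `&` moved (h j) B)))).
  apply: le_measure; rewrite ?inE.
  - by apply: measurableI => //; apply: measurable_moved; exact: measurableU.
  - by apply: measurableU; exact: measurableI.
  - by rewrite -setIUr; apply: setIS; exact: movedU.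
by apply: measureU2; exact: measurableI.
Qed.

Lemma continuous_set0 : continuous_set set0.
Proof.
split => // N; apply: small_le (@small_cst0 R); apply: nearW => j.
rewrite (_ : moved _ _ = set0) ?setI0 ?measure0//.
by rewrite -subset0 => z; rewrite /moved/shift/=; tauto.
Qed.

Lemma shift_box (h' : V) N : (forall i, `|h' ord0 i| <= 1) ->
  box N `<=` shift h' (box N.+1).
Proof.
move=> h1 z zN i; rewrite mxE (le_trans (ler_normD _ _))// -natr1.
by apply: lerD; [exact: zN|exact: h1].
Qed.

Lemma box_small_tail A B N (e : R) : measurable A -> 
  (forall k, measurable (B k)) -> nondecreasing_seq B -> A = \bigcup_k B k ->
  0 < e -> exists k, (mu (box N `&` (A `\` B k)) <= e%:E)%E.
Proof.
move=> mA mB ndB AB e0.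
pose F k := box N `&` (A `\` B k).
have mF k : measurable (F k).
  by apply: measurableI; [exact: measurable_box|exact: measurableD].
have F0 : \bigcap_k F k = set0.
  rewrite -subset0 => x Fx; have [_ []] := Fx 0%N I; rewrite AB => -[k _ Bx] _.
  by have [_ []] := Fx k I.
have : mu \o F @ \oo --> mu (\bigcap_k F k).
  apply: nonincreasing_cvg_mu => //.
  - apply: le_lt_trans (borel_lebesgue_box R n N).
    by apply: le_measure; rewrite ?inE//; [exact: measurable_box|move=> x []].
  - exact: bigcapT_measurable.
  - move=> k l kl; apply/subsetPset; apply: setIS; apply: setDS.
    exact/subsetPset/ndB.
rewrite F0 measure0 => /small_cvg => /(_ (fun=> measure_ge0 _ _)) /(_ _ e0) [k _ /(_ k (leqnn k)) Fk].
by exists k.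
Qed.

Lemma continuous_set_bigcup (F : (set V)^nat) :
  (forall k, continuous_set (F k)) -> continuous_set (\bigcup_k F k).
Proof.
move=> cF; have mF k : measurable (F k) by have [] := cF k.
have mU : measurable (\bigcup_k F k) by exact: bigcupT_measurable.
split => // N.
pose B k := \big[setU/set0]_(i < k) F i.
have cB k : continuous_set (B k).
  rewrite /B; elim: k => [|k IH]; first by rewrite big_ord0; exact: continuous_set0.
  by rewrite big_ord_recr; exact: continuous_setU.
have mB k : measurable (B k) by have [] := cB k.
have BF k : B k `<=` \bigcup_k F k.
  by rewrite /B -bigcup_mkord => x [i _ Fx]; exists i.
apply: small_approx => e e0.
have e2 : 0 < e / 2 by rewrite divr_gt0.
(* The tail is made small on the larger box [N.+1], since a translation by at most 1 in each
   coordinate may carry [box N] out of itself but not out of [box N.+1]. It is counted twice, hence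
   [e / 2]. *)
have [k Bk] : exists k, (mu (box N.+1 `&` ((\bigcup_k F k) `\` B k)) <= (e / 2)%:E)%E.
  apply: box_small_tail => //.
    by move=> i j ij; apply/subsetPset; exact: subset_bigsetU.
  apply/seteqP; split => [x [k _ Fx]|x [k _ /BF]]//.
  by exists k.+1 => //; rewrite /B big_ord_recr/=; right.
exists (fun j => mu (box N `&` moved (h j) (B k))); first by have [_] := cB k; exact.
have := h0 ltr01; apply: filterS => j h1.
pose D := \bigcup_k F k `\` B k; have mD : measurable D by exact: measurableD.
have mbN m := @measurable_box R n m.
have mND : measurable (box N.+1 `&` D) by exact: measurableI.
have mm : measurable (box N `&` moved (h j) (B k)).
  by apply: measurableI => //; exact: measurable_moved.
have ms : measurable (shift (h j) (box N.+1 `&` D)) by exact: measurable_shift.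
apply: (@le_trans _ _ (mu (box N `&` moved (h j) (B k)
  `|` (box N.+1 `&` D) `|` shift (h j) (box N.+1 `&` D)))).
  apply: le_measure; rewrite ?inE.
  - by apply: measurableI => //; exact: measurable_moved.
  - by apply: measurableU => //; exact: measurableU.
  - move=> z [zN /(moved_sub (BF k))] [[?|?]|?].
    + by left; left.
    + left; right; split => // i; rewrite (le_trans (zN i))// ler_nat.
      exact: leqnSn.
    + by right; split => //; exact: (shift_box h1 zN).
apply: (@le_trans _ _ (mu (box N `&` moved (h j) (B k) `|` (box N.+1 `&` D)) +
    mu (shift (h j) (box N.+1 `&` D)))%E).
  by apply: measureU2 => //; exact: measurableU.
rewrite borel_lebesgue_shift// (splitr e) EFinD addeA; apply: leeD => //.
apply: (@le_trans _ _ (mu (box N `&` moved (h j) (B k)) + mu (box N.+1 `&` D))%E).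
  exact: measureU2.
exact: leeD2l.
Qed.

(** A translation by at most [q] only affects the slab of half-width [q] around the bounding
    hyperplane. Within a box these slabs have finite measure and shrink to a null set. *)
Lemma continuous_set_halfspace (i : 'I_n) (a : R) :
  continuous_set (rV_coord i @^-1` `]a, +oo[%classic).
Proof.
split.
  by rewrite -[X in measurable X]setTI; exact: measurable_rV_coord.
move=> N e e0.
pose F k := box N `&` (rV_coord i @^-1` `[a - k.+1%:R^-1, a + k.+1%:R^-1]%classic : set V).
have mc (A : set R) : measurable A -> measurable (rV_coord i @^-1` A : set V).
  by move=> mA; rewrite -[X in measurable X]setTI; exact: measurable_rV_coord.
have mbN := @measurable_box R n N.
have mF k : measurable (F k) by apply: measurableI => //; exact: mc.
have : mu \o F @ \oo --> mu (\bigcap_k F k).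
  apply: nonincreasing_cvg_mu => //.
  - apply: le_lt_trans (borel_lebesgue_box R n N).
    by apply: le_measure; rewrite ?inE//; move=> x [].
  - exact: bigcapT_measurable.
  - move=> k l kl; apply/subsetPset; apply: setIS => x /=; rewrite !in_itv/=.
    have : l.+1%:R^-1 <= k.+1%:R^-1 :> R by rewrite lef_pV2 ?posrE// ler_nat.
    move: (l.+1%:R^-1) (k.+1%:R^-1) => p q.
    by move=> ? /andP[? ?]; apply/andP; split; lra.
have F0 : mu (\bigcap_k F k) = 0%E.
  apply: subset_measure0 (borel_lebesgue_hyperplane i a) => //.
  - exact: bigcapT_measurable.
  - exact: mc.
  - move=> x Fx /=; apply/eqP; rewrite -subr_eq0 -normr_le0; apply/ler_addgt0Pr.
    move=> _/posnumP[d]; rewrite add0r.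
    have [k _ /(_ k (leqnn k))/ltW kd] := near_infty_natSinv_lt d.
    apply: le_trans kd; have [_] := Fx k I; rewrite /= in_itv/=.
    move: (k.+1%:R^-1) (rV_coord i x) => p y.
    by rewrite ler_norml => /andP[? ?]; apply/andP; split; lra.
rewrite F0 => /small_cvg => /(_ (fun=> measure_ge0 _ _)) /(_ _ e0) [k _ /(_ k (leqnn k)) Fk].
have k0 : 0 < k.+1%:R^-1 :> R by rewrite invr_gt0.
have := h0 k0; apply: filterS => j /(_ i) hi; apply: le_trans Fk.
apply: le_measure; rewrite ?inE//.
  by apply: measurableI => //; apply: measurable_moved; exact: mc.
apply: setIS => z; rewrite /moved /shift/= !in_itv/= !andbT /rV_coord mxE.
move: hi; move: (k.+1%:R^-1) => q; rewrite ler_norml => /andP[? ?].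
by move=> [[? /negP]|[? /negP]]; rewrite -leNgt => ?; apply/andP; split; lra.
Qed.

(** Two generation arguments are nested: Borel sets of the space come from preimages under
    coordinates, and Borel sets of the line from open rays. *)
Lemma continuous_set_measurable (A : set V) : measurable A -> continuous_set A.
Proof.
move: A; apply: smallest_sub.
  split; first exact: continuous_set0.
    by move=> A cA; rewrite setTD; exact: continuous_setC.
  exact: continuous_set_bigcup.
rewrite -bigcup_seq => A [i _ [B mB <-]]; rewrite setTI.
have {}mB : (@ocitv R).-sigma.-measurable B := mB.
move: mB; rewrite RGenOInfty.measurableE; move: B; apply: smallest_sub.
  split; first by rewrite preimage_set0; exact: continuous_set0.
    by move=> B cB; rewrite setTD -preimage_setC; exact: continuous_setC.
  by move=> F cF; rewrite preimage_bigcup; exact: continuous_set_bigcup.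
by move=> _ [a ->]; exact: continuous_set_halfspace.
Qed.

(** Finite measure removes the localisation to a box: [A] has little mass outside a large one. *)
Lemma small_moved (A : set V) : measurable A -> (mu A < +oo)%E ->
  small (fun j => mu (moved (h j) A)).
Proof.
move=> mA Aoo; apply: small_approx => e e0.
have e2 : 0 < e / 2 by rewrite divr_gt0.
have mb N := @measurable_box R n N.
pose F N := A `\` box N.
have mF N : measurable (F N) by exact: measurableD.
have F0 : \bigcap_N F N = set0.
  rewrite -subset0 => x Fx.
  pose M := \sum_i `|x ord0 i|.
  have [_] := Fx (Num.trunc M).+1 I; apply => i /=.
  apply: (@le_trans _ _ M); last by rewrite ltW// truncnS_gt.
  by rewrite /M (bigD1 i)//= lerDl sumr_ge0.
have : mu \o F @ \oo --> mu (\bigcap_k F k).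
  apply: nonincreasing_cvg_mu => //.
  - by apply: le_lt_trans Aoo; apply: le_measure; rewrite ?inE// => x [].
  - exact: bigcapT_measurable.
  - move=> k l kl; apply/subsetPset; apply: setDS => x xk i.
    by rewrite (le_trans (xk i))// ler_nat.
rewrite F0 measure0 => /small_cvg => /(_ (fun=> measure_ge0 _ _)) /(_ _ e2) [N _ /(_ N (leqnn N)) FN].
have mAN : measurable (A `&` box N) by exact: measurableI.
(* Once the translation is at most 1 in each coordinate, the symmetric difference for [A] cut to
   [box N] lies in [box N.+1], so that this box loses nothing. *)
exists (fun j => mu (box N.+1 `&` moved (h j) (A `&` box N))).
  by have [_] := continuous_set_measurable mAN; exact.
have h10 : 0 < 1 :> R by []; have := h0 h10; apply: filterS => j h1.
have := @moved_le A (A `&` box N) (h j) (@subIsetl _ _ _) mA mAN.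
rewrite setDIr setDv set0U => /le_trans; apply.
rewrite (splitr e) EFinD; apply: leeD; last exact: leeD.
apply: le_measure; rewrite ?inE.
- exact: measurable_moved.
- by apply: measurableI => //; exact: measurable_moved.
- move=> z mz; split => //; case: mz => -[[_ zN] _].
    move=> i; rewrite (le_trans (zN i))// ler_nat; exact: leqnSn.
  move=> i; rewrite -natr1; rewrite (_ : z ord0 i = (z + h j) ord0 i - h j ord0 i).
    by rewrite (le_trans (ler_normB _ _))// lerD.
  by rewrite mxE addrK.
Qed.

End translation.

(** * Translations of integrable functions *)

Section L1_translation.
Context (R : realType) (n : nat).
Local Notation mu := (borel_lebesgue R n).
Local Notation V := 'rV[R]_n.
Local Open Scope ereal_scope.

Lemma measurable_addrV (b : V) : measurable_fun setT (fun z : V => z + b)%R.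
Proof.
rewrite (_ : (fun z => _) = rV_aff 1 b); first exact: measurable_rV_aff.
by apply/funext => z; rewrite /rV_aff scale1r.
Qed.

Lemma ge0_integral_shift (b : V) (f : V -> \bar R) :
  measurable_fun setT f -> (forall x, 0 <= f x) ->
  \int[mu]_z f (z + b)%R = \int[mu]_z f z.
Proof.
move=> mf f0.
transitivity (\int[pushforward mu (fun z : V => z + b)%R]_z f z).
  by rewrite ge0_integral_pushforward//; exact: measurable_addrV.
apply: eq_measure_integral => [|mb A mA _]; first exact: measurable_addrV.
change (mu (shift b A) = mu A); exact: borel_lebesgue_shift.
Qed.

Context (h : nat -> V)
  (h0 : forall e : R, (0 < e)%R -> \forall j \near \oo, forall i, (`|h j ord0 i| <= e)%R).

Import HBSimple.

Definition L1_continuous (f : V -> R) := measurable_fun setT f /\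
  small (fun j => \int[mu]_z `|f (z + h j)%R - f z|%:E).

Let measurable_diff (f : V -> R) j : measurable_fun setT f ->
  measurable_fun setT (fun z : V => `|f (z + h j)%R - f z|%:E).
Proof.
move=> mf; apply/measurable_EFinP; apply: measurableT_comp => //.
apply: measurable_funB => //; apply: (measurableT_comp mf).
exact: measurable_addrV.
Qed.

Lemma L1_continuousD (f g : V -> R) :
  L1_continuous f -> L1_continuous g -> L1_continuous (f \+ g)%R.
Proof.
move=> [mf sf] [mg sg]; have mfg : measurable_fun setT (f \+ g)%R by exact: measurable_funD.
split => //; apply: small_le (smallD sf sg); apply: nearW => j.
rewrite -ge0_integralD//; [|exact: measurable_diff|exact: measurable_diff].
apply: ge0_le_integral => //.
- exact: measurable_diff.
- by apply: emeasurable_funD; exact: measurable_diff.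
- by move=> z _; rewrite -EFinD lee_fin /= opprD addrACA ler_normD.
Qed.

(** Finiteness is asked only for [c != 0]: the zero level set of an integrable simple function may
    have infinite measure. *)
Lemma L1_continuous_indic (c : R) (A : set V) :
  measurable A -> (c != 0%R -> mu A < +oo) -> L1_continuous (fun z => c * \1_A z)%R.
Proof.
move=> mA Aoo; have mf : measurable_fun setT (fun z => c * \1_A z)%R.
  by apply: measurable_funM => //; exact: measurable_indic.
split => //; have [->|c0] := eqVneq c 0%R.
  apply: small_le (@small_cst0 R); apply: nearW => j.
  by rewrite integral0_eq// => z _; rewrite !mul0r subrr normr0.
apply: small_le (smallZ (normr_ge0 c) (small_moved h0 mA (Aoo c0))).
apply: nearW => j; rewrite -(setIT (moved _ _)) -integral_indic//; last first.
  exact: measurable_moved.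
rewrite -ge0_integralZl//; last first.
  by apply/measurable_EFinP; apply: measurable_indic; exact: measurable_moved.
apply: ge0_le_integral => //.
- exact: measurable_diff.
- apply/measurable_EFinP; apply: measurable_funM => //.
  by apply: measurable_indic; exact: measurable_moved.
- move=> z _; rewrite -EFinM lee_fin -mulrBr normrM ler_wpM2l//.
  rewrite !indicE; have [zm|zm] := boolP (z \in moved _ _).
    by case: (_ \in _); case: (_ \in _); rewrite ?subrr ?subr0 ?sub0r ?normrN ?normr0 ?normr1.
  suff -> : (z + h j \in A)%R = (z \in A) by rewrite subrr normr0.
  apply/idP/idP => /set_mem Az; apply/mem_set; apply: contrapT => nA;
    move/negP: zm; apply; apply/mem_set; [right|left]; by split.
Qed.

(** Approximation in L^1 by simple functions; the translates of [f] and of its approximation are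
    equally close, by invariance of the measure. *)
Lemma L1_continuous_integrable (f : V -> R) :
  mu.-integrable setT (EFin \o f) ->
  small (fun j => \int[mu]_z `|f (z + h j)%R - f z|%:E).
Proof.
move=> intf; have [g [intg _ /small_cvg gf]] := approximation_sfun_integrable measurableT intf.
have mf : measurable_fun setT f by case/integrableP : intf => /measurable_EFinP.
have mg k : measurable_fun setT (g k) by exact: measurable_funP.
have g0 k : 0 <= \int[mu]_z `|(EFin \o f) z - (g k z)%:E| by exact: integral_ge0.
have {}gf := gf g0.
have sg k : small (fun j => \int[mu]_z `|g k (z + h j)%R - g k z|%:E).
  suff : L1_continuous (g k) by case.
  rewrite (_ : (g k : V -> R) = \sum_(y <- fset_set (range (g k)))
      (fun z => y * \1_(g k @^-1` [set y]) z))%R; last first.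
    apply/funext => z; rewrite fimfunE fsbig_finite//= fct_sumE.
    by apply: eq_bigr.
  apply: big_ind.
  - split; first exact: measurable_cst.
    apply: small_le (@small_cst0 R); apply: nearW => j.
    by rewrite integral0_eq// => z _; rewrite subrr normr0.
  - exact: L1_continuousD.
  - move=> y _; apply: L1_continuous_indic => // y0.
    (* Chebyshev: [|y|] times the measure of the level set at [y] is at most the integral of
       [|g k|]. *)
    rewrite -(@lte_pmul2l _ `|y|%:E)//; last by rewrite lte_fin normr_gt0.
    rewrite gt0_muley ?lte_fin ?normr_gt0//.
    case/integrableP : (intg k) => _; apply: le_lt_trans.
    rewrite -integral_cst//.
    rewrite (_ : integral _ _ _ = \int[mu]_(z in g k @^-1` [set y]) `|(EFin \o g k) z|).
      2: by apply: eq_integral => z /set_mem /= ->.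
    apply: ge0_subset_integral => //.
    by apply/measurable_EFinP; exact: measurableT_comp.
apply: small_approx => e e0.
have e2 : (0 < e / 2)%R by rewrite divr_gt0.
have [k _ /(_ k (leqnn k)) fg] := gf _ e2.
exists (fun j => \int[mu]_z `|g k (z + h j)%R - g k z|%:E) => //.
apply: nearW => j.
have mfg : measurable_fun setT (fun z => `|f z - g k z|%:E).
  by apply/measurable_EFinP; apply: measurableT_comp => //; exact: measurable_funB.
have mfgh : measurable_fun setT (fun z : V => `|f (z + h j)%R - g k (z + h j)%R|%:E).
  by apply: (measurableT_comp mfg); exact: measurable_addrV.
apply: (@le_trans _ _ (\int[mu]_z (`|g k (z + h j)%R - g k z|%:E +
    (`|f z - g k z|%:E + `|f (z + h j)%R - g k (z + h j)%R|%:E)))).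
  apply: ge0_le_integral => //.
  - exact: measurable_diff.
  - by apply: emeasurable_funD; [exact: measurable_diff|exact: emeasurable_funD].
  - move=> z _; rewrite -!EFinD lee_fin.
    rewrite (_ : f (z + h j) - f z = (g k (z + h j) - g k z) +
      ((g k z - f z) + (f (z + h j) - g k (z + h j))))%R; last by ring.
    rewrite (le_trans (ler_normD _ _))// lerD2l (le_trans (ler_normD _ _))//.
    by rewrite lerD2r distrC.
rewrite ge0_integralD//; [|exact: measurable_diff|by move=> z _; rewrite adde_ge0|exact: emeasurable_funD].
apply: leeD2l; rewrite ge0_integralD// (splitr e) EFinD.
rewrite (@ge0_integral_shift (h j) (fun z => `|f z - g k z|%:E))//.
by apply: leeD.
Qed.

End L1_translation.

(** * Translations averaged against a finite measure *)

Section averaged_translation.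
Context (R : realType) (n : nat).
Local Notation mu := (borel_lebesgue R n).
Local Notation V := 'rV[R]_n.
Local Open Scope ereal_scope.
Context (P : {finite_measure set (rVL R n) -> \bar R}) (P_ac : P `<< lebesgue R n).
Context (k : V -> R) (N : set V).
Context (mk : measurable_fun setT (k : rVL R n -> R)).
Context (mN : measurable N) (N0 : mu N = 0).
Local Notation k' := (k \_ (~` N)).
Context (mk' : measurable_fun setT k') (intk' : mu.-integrable setT (EFin \o k')).

(** Built from the Borel version [k'], so as to be jointly measurable. The factor [z] carries the
    Borel sigma-algebra and the factor [y], where [P] lives, the Lebesgue one. *)
Let F (e : R) (p : V * rVL R n) : \bar R := `|k' (p.1 - e *: p.2)%R - k' p.1|%:E.

Let measurable_F e : measurable_fun setT (F e).
Proof.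
apply/measurable_EFinP; apply: measurableT_comp => //; apply: measurable_funB.
  apply: (measurableT_comp mk'); apply: measurable_to_rV => i.
  rewrite (_ : _ \o _ = fun p : V * rVL R n =>
      (rV_coord i p.1 - e * (rV_coord i : rVL R n -> R) p.2)%R); last first.
    by apply/funext => p; rewrite /= /rV_coord !mxE.
  apply: measurable_funB.
    by apply: measurableT_comp => //; exact: measurable_rV_coord.
  apply: measurable_funM => //; apply: measurableT_comp => //.
  move=> _ A mA; rewrite setTI; apply: borel_measurable_rVL.
  by rewrite -[X in measurable X]setTI; exact: measurable_rV_coord.
by apply: (measurableT_comp mk').
Qed.

Let F_ge0 e p : 0 <= F e p. Proof. by rewrite lee_fin. Qed.

Let translate_null (e : R) (z : V) : e != 0%R -> lebesgue R n [set y | N (z - e *: y)%R] = 0.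
Proof.
move=> e0; rewrite (_ : [set y | _] = rV_aff (- e)%R z @^-1` N).
  by rewrite lebesgue_aff ?oppr_eq0// lebesgue_borelE// N0 mule0.
by apply/seteqP; split => y /=; rewrite /rV_aff scaleNr addrC.
Qed.

(** The integrands differ only where [z - e *: y] lies in [N]. This set of [y] is an affine preimage
    of a null set, hence Lebesgue null, hence [P]-null. *)
Let mean_version (e : R) (z : V) : e != 0%R -> ~ N z ->
  \int[P]_y `|k (z - e *: y)%R - k z|%:E = \int[P]_y F e (z, y).
Proof.
move=> e0 Nz.
pose M := [set y : V | N (z - e *: y)%R].
have mM : measurable (M : set (rVL R n)).
  rewrite (_ : M = rV_aff (- e)%R z @^-1` N).
    by apply: borel_measurable_rVL; rewrite -[X in measurable X]setTI; exact: measurable_rV_aff.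
  by apply/seteqP; split => y /=; rewrite /rV_aff scaleNr addrC.
have mkz : measurable_fun setT ((fun y => k (z - e *: y)%R) : rVL R n -> R).
  rewrite (_ : (fun y => _) = k \o rV_aff (- e)%R z); last first.
    by apply/funext => y /=; rewrite /rV_aff scaleNr addrC.
  apply: (measurableT_comp mk); apply: measurable_rV_aff_lebesgue.
  by rewrite oppr_eq0.
apply: ge0_ae_eq_integral.
- exact: measurableT.
- apply/measurable_EFinP.
  have mkB : measurable_fun setT ((fun y => k (z - e *: y) - k z)%R : rVL R n -> R).
    by apply: measurable_funB; [exact: mkz|exact: measurable_cst].
  exact: (measurableT_comp (@normr_measurable R setT) mkB).
- exact: (measurable_fun_pair2 z (measurable_F e)).
- by move=> y _; rewrite lee_fin.
- by move=> y _; exact: F_ge0.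
- exists M; split => //.
    by move/null_content_dominatesP : P_ac; apply => //; exact: translate_null.
  move=> y /= /not_implyP[_]; apply: contra_notP => My.
  by rewrite /F/= !patchE !mem_set.
Qed.

(** After the exchange of integrals, the inner one tends to 0 for each [y] by L^1-continuity of
    translations. It never exceeds twice the L^1 norm of [k'], a constant and so integrable against
    the finite measure [P]. *)
Let cvg_mean (e_ : nat -> R) : e_ @ \oo --> (0 : R)%R ->
  small (fun j => \int[mu]_z \int[P]_y F (e_ j) (z, y)).
Proof.
move=> e0; under eq_fun do rewrite fubini_tonelli//.
pose G j y := \int[mu]_z F (e_ j) (z, y).
have G0 j y : 0 <= G j y by exact: integral_ge0.
have mG j : measurable_fun setT (G j) by exact: measurable_fun_fubini_tonelli_G.
have G_0 y : small (G^~ y).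
  have h0 : forall d : R, (0 < d)%R -> \forall j \near \oo, forall i,
      (`|(- (e_ j *: y)) ord0 i| <= d)%R.
    move=> d d0; apply: filter_forall => i.
    have : (e_ j * y ord0 i)%R @[j --> \oo] --> (0 : R)%R.
      by rewrite -(mul0r (y ord0 i)); apply: cvgMl.
    move=> /cvgrPdist_le/(_ d d0); apply: filterS => j.
    by rewrite sub0r !mxE.
  exact: L1_continuous_integrable h0 _ intk'.
have C : \int[mu]_z `|k' z|%:E < +oo by case/integrableP : intk'.
pose c := 2%:E * \int[mu]_z `|k' z|%:E.
have mabs : measurable_fun setT (fun z : V => `|k' z|%:E).
  by apply/measurable_EFinP; exact: measurableT_comp.
have Gc j y : G j y <= c.
  apply: (@le_trans _ _ (\int[mu]_z (`|k' (z - e_ j *: y)%R|%:E + `|k' z|%:E))).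
    apply: ge0_le_integral => //.
    - exact: (measurable_fun_pair1 y (measurable_F (e_ j))).
    - apply: emeasurable_funD => //; apply: (measurableT_comp mabs).
      exact: measurable_addrV.
    - by move=> z _; rewrite -EFinD lee_fin ler_normB.
  rewrite ge0_integralD//; last first.
    by apply: (measurableT_comp mabs); exact: measurable_addrV.
  rewrite (@ge0_integral_shift _ _ (- (e_ j *: y))%R (fun z => `|k' z|%:E))//.
  by rewrite /c -[X in X + X]mul1e -ge0_muleDl.
have cfin : c \is a fin_num.
  by rewrite ge0_fin_numE ?mule_ge0 ?integral_ge0// lte_mul_pinfty.
have ic : P.-integrable setT (cst c).
  rewrite -(fineK cfin); by apply: finite_measure_integrable_cst; exact: measurableT.
have mc : measurable_fun setT (cst 0 : rVL R n -> \bar R) by exact: measurable_cst.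
have Gae : {ae P, forall y, setT y -> G^~ y @ \oo --> cst 0 y}.
  by apply: aeW => y _; apply/small_cvg => //; exact: G_0.
have Gle : {ae P, forall y j, setT y -> `|G j y| <= cst c y}.
  by apply: aeW => y j _; rewrite gee0_abs//; exact: Gc.
have [_ _] := dominated_convergence measurableT mG mc Gae ic Gle.
rewrite integral0 => /small_cvg; apply => j.
exact: integral_ge0.
Qed.

Lemma small_averaged_translation (e_ : nat -> R) (t : R) :
  (forall j, (0 < e_ j)%R) -> e_ @ \oo --> (0 : R)%R -> (0 < t)%R ->
  small (fun j => lebesgue R n
    [set z | t%:E < \int[P]_y `|k (z - e_ j *: y)%R - k z|%:E]).
Proof.
move=> e_gt0 e0 t0.
have ti0 : (0 <= t^-1)%R by rewrite invr_ge0 ltW.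
apply: small_le (smallZ ti0 (cvg_mean e0)).
apply: nearW => j.
pose E z := \int[P]_y F (e_ j) (z, y).
have E0 z : 0 <= E z by exact: integral_ge0.
have mE : measurable_fun setT E by exact: measurable_fun_fubini_tonelli_F.
pose S := setT `&` [set z | t%:E <= `|E z|].
have mS : measurable S.
  by apply: emeasurable_fun_c_infty => //; exact: measurableT_comp.
apply: (@le_trans _ _ (lebesgue R n N + lebesgue R n S)).
  apply: le_trans (lebesgueU_le N S); apply: le_lebesgue => z /= tz.
  have [Nz|Nz] := pselect (N z); [by left|right; split => //=].
  by rewrite gee0_abs// /E -mean_version ?gt_eqF// ltW.
rewrite lebesgue_borelE// N0 add0e lebesgue_borelE//.
rewrite muleC lee_pdivlMr// muleC.
(* Markov's inequality for [E]; the points of [N], where [E] may differ from the original mean, have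
   measure 0. *)
have := @le_integral_comp_abse _ _ _ mu setT measurableT E t id
  (@measurable_id _ _ _) (fun _ h => h) (fun _ _ _ _ h => h) mE t0.
move=> /le_trans; apply; rewrite le_eqVlt; apply/orP; left; apply/eqP.
by apply: eq_integral => z _; rewrite gee0_abs.
Qed.

End averaged_translation.

(** * Polar coordinates *)

Section enorm_theory.
Context (R : realType) (n : nat).
Implicit Types x : 'rV[R]_n.

Lemma enorm_ge0 x : 0 <= enorm x.
Proof. exact: sqrtr_ge0. Qed.

Lemma enorm_eq0 x : (enorm x == 0) = (x == 0).
Proof.
rewrite sqrtr_eq0; apply/idP/eqP => [x0|->]; last first.
  by rewrite big1// => i _; rewrite mxE expr0n.
have {}x0 : \sum_i x ord0 i ^+ 2 == 0.
  by rewrite eq_le x0 sumr_ge0// => i _; exact: sqr_ge0.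
apply/rowP => i; rewrite mxE; apply/eqP; rewrite -sqrf_eq0.
move: x0; rewrite psumr_eq0; last by move=> j _; exact: sqr_ge0.
by move/allP => /(_ i); rewrite mem_index_enum => /(_ isT).
Qed.

Lemma enorm_gt0 x : (0 < enorm x) = (x != 0).
Proof. by rewrite lt_neqAle enorm_ge0 andbT eq_sym enorm_eq0. Qed.

Lemma enormZ (a : R) x : enorm (a *: x) = `|a| * enorm x.
Proof.
rewrite /enorm -sqrtr_sqr -sqrtrM ?sqr_ge0//; congr Num.sqrt.
by rewrite mulr_sumr; apply: eq_bigr => i _; rewrite mxE exprMn.
Qed.

Lemma radialZ (a : R) x : 0 < a -> radial (a *: x) = radial x.
Proof.
move=> a0; rewrite /radial enormZ gtr0_norm// scalerA invfM mulrAC mulVf ?mul1r//.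
by rewrite gt_eqF.
Qed.

Lemma coord_le_enorm x i : `|x ord0 i| <= enorm x.
Proof.
rewrite -sqrtr_sqr ler_sqrt ?sumr_ge0//; last by move=> j _; exact: sqr_ge0.
by rewrite (bigD1 i)//= lerDl sumr_ge0// => j _; exact: sqr_ge0.
Qed.

End enorm_theory.

(** * Volume of star-shaped sets as an integral over the sphere *)

Section cone_distribution.
Context (R : realType) (n : nat) (n_gt0 : (0 < n)%N).
Local Notation m := (lebesgue R n).
Local Notation V := 'rV[R]_n.

(** Bounding the power [n] of the norm, not the norm itself, makes the volume linear in [t]. The
    origin, which has no direction, is left out. *)
Definition sector (A : set (rVS R n)) (t : R) : set (rVL R n) :=
  [set x | A (radial x) /\ 0 < enorm x /\ enorm x ^+ n < t].

Lemma measurable_enorm_lebesgue : measurable_fun setT (@enorm R n : rVL R n -> R).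
Proof.
move=> _ A mA; rewrite setTI; apply: borel_measurable_rVL.
by rewrite -[X in measurable X]setTI; exact: measurable_enorm.
Qed.

Lemma measurable_subgraph (g : rVS R n -> R) : measurable_fun setT g ->
  measurable ([set x | 0 < enorm x /\ enorm x ^+ n < g (radial x)] : set (rVL R n)).
Proof.
move=> mg; have me := measurable_enorm_lebesgue.
have mgr : measurable_fun setT (fun x : rVL R n => g (radial x)).
  exact: (measurableT_comp mg (@measurable_radial R n)).
rewrite (_ : [set x | _] = (@enorm R n : rVL R n -> R) @^-1` `]0, +oo[%classic `&`
   (fun x : rVL R n => g (radial x) - enorm x ^+ n) @^-1` `]0, +oo[%classic).
  apply: measurableI; first by rewrite -[X in measurable X]setTI; exact: me.
  rewrite -[X in measurable X]setTI.
  by apply: (measurable_funB mgr (measurable_funX n me)) => //.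
by apply/seteqP; split => x /=; rewrite !in_itv/= !andbT subr_gt0.
Qed.

Lemma powR_natVK (t : R) : 0 < t -> (t `^ (n%:R^-1)) ^+ n = t.
Proof.
move=> t0; rewrite -powR_mulrn ?powR_ge0// -powRrM.
by rewrite mulVf ?pnatr_eq0 -?lt0n// powRr1 ?ltW.
Qed.

Lemma sectorE A (t : R) : 0 < t ->
  sector A t = rV_aff (t `^ (n%:R^-1))^-1 0 @^-1` sector A 1.
Proof.
move=> t0; have s0 : 0 < (t `^ (n%:R^-1))^-1 by rewrite invr_gt0 powR_gt0.
have sn : (t `^ (n%:R^-1))^-1 ^+ n = t^-1 by rewrite exprVn powR_natVK.
by apply/seteqP; split => x; rewrite /sector /preimage /= /rV_aff addr0 radialZ// enormZ;
  rewrite gtr0_norm// exprMn sn ltr_pdivrMl// mulr1 pmulr_rgt0.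
Qed.

Lemma measurable_sector A t : measurable A -> measurable (sector A t).
Proof.
move=> mA; rewrite (_ : sector A t = [set x | 0 < enorm x /\ enorm x ^+ n < (cst t) (radial x)]
   `&` (@radial R n @^-1` A)).
  apply: measurableI; first exact: measurable_subgraph.
  by rewrite -[X in measurable X]setTI; exact: measurable_radial.
by apply/seteqP; split => x /=; rewrite /sector/=; tauto.
Qed.

Lemma lebesgue_sector_scale A (t : R) : 0 < t ->
  (m (sector A t) = t%:E * m (sector A 1))%E.
Proof.
move=> t0; have s0 : 0 < (t `^ (n%:R^-1)) by rewrite powR_gt0.
rewrite (sectorE _ t0) lebesgue_aff ?invr_eq0 ?gt_eqF//; congr (_%:E * _)%E.
by rewrite normfV exprVn invrK gtr0_norm// powR_natVK.
Qed.

Lemma lebesgue_sector1_lty A : (m (sector A 1) < +oo)%E.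
Proof.
apply: (@le_lt_trans _ _ (m (box 1))); last first.
  by rewrite lebesgue_borelE; [exact: borel_lebesgue_box|exact: measurable_box].
apply: le_lebesgue => x [_ [_ x1]] i; rewrite (le_trans (coord_le_enorm _ _))//.
apply: ltW; rewrite ltNge; apply/negP => x1'.
by move: x1; rewrite ltNge => /negP; apply; exact: exprn_ege1.
Qed.

(* The sphere is not known to be null here: the closed sector is squeezed
   between the open sectors at [1] and at [1 + d], whose volumes scale. *)
Lemma cone_volume_sector A : measurable A -> cone_volume A = m (sector A 1).
Proof.
move=> mA; have sfin : m (sector A 1) \is a fin_num.
  by rewrite ge0_fin_numE ?mu_ext_ge0// lebesgue_sector1_lty.
change (m (@radial R n @^-1` A `&` @punctured_ball R n) = m (sector A 1)).
apply/eqP; rewrite eq_le; apply/andP; split; last first.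
  apply: le_lebesgue => x [Ax [x0 x1]]; split => //=; rewrite /punctured_ball/= x0/=.
  by rewrite leNgt; apply/negP => /ltW x1'; move: x1; rewrite ltNge exprn_ege1.
apply/lee_addgt0Pr => e e0.
(* Chosen so that [d] times the volume of the unit sector is at most [e]; the [+ 1] covers a sector
   of volume 0. *)
pose d := e / (fine (m (sector A 1)) + 1).
have f0 : 0 <= fine (m (sector A 1)) by rewrite fine_ge0// mu_ext_ge0.
have d0 : 0 < d by rewrite divr_gt0// ltr_wpDl.
apply: (@le_trans _ _ (m (sector A (1 + d)))).
  apply: le_lebesgue => x [Ax /andP[x0 x1]]; do 2 split => //.
  by rewrite (@le_lt_trans _ _ 1)// ?ltrDl// exprn_ile1// ltW.
rewrite lebesgue_sector_scale ?addr_gt0// -(fineK sfin) -EFinM -EFinD lee_fin.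
rewrite mulrDl mul1r lerD2l /d mulrAC ler_pdivrMr ?ltr_wpDl// ler_pM2l//.
by rewrite lerDl.
Qed.

Lemma lebesgue_sector A (t : R) : 0 <= t -> measurable A ->
  (m (sector A t) = t%:E * cone_volume A)%E.
Proof.
rewrite le_eqVlt => /predU1P[<-|t0] mA; last first.
  by rewrite lebesgue_sector_scale// cone_volume_sector.
rewrite mul0e (_ : sector A 0 = set0) ?measure0//.
rewrite -subset0 => x [_ [x0]]; apply/negP; rewrite -leNgt.
by rewrite exprn_ge0// enorm_ge0.
Qed.

Import HBNNSimple.

(** Integration in polar coordinates, read as the volume of a subgraph. For a simple function the
    subgraph is a finite disjoint union of sectors whose volumes are the terms of its integral; the
    general case follows by monotone limits on both sides. *)
Lemma integral_cone_volume (g : rVS R n -> R) :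
  measurable_fun setT g -> (forall x, 0 <= g x) ->
  (\int[@cone_volume R n]_x (g x)%:E =
   m [set x | (0 < enorm x)%R /\ (enorm x ^+ n < g (radial x))%R])%E.
Proof.
move=> mg g0; pose S (f : rVS R n -> R) : set (rVL R n) :=
  [set x | 0 < enorm x /\ enorm x ^+ n < f (radial x)].
have mEg : measurable_fun setT (EFin \o g) by exact/measurable_EFinP.
have Eg0 x : setT x -> (0 <= (EFin \o g) x)%E by rewrite lee_fin.
have simple (f : {nnsfun rVS R n >-> R}) : sintegral (@cone_volume R n) f = m (S f).
  have -> : S f = \bigcup_(y in range f) sector (f @^-1` [set y]) y.
    apply/seteqP; split => x; first by move=> [x0 xf]; exists (f (radial x)).
    by move=> [_ [y _ <-]] [/= <-].
  have mf y : measurable (f @^-1` [set y]).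
    by rewrite -[X in measurable X]setTI; exact: measurable_funP.
  rewrite measure_fin_bigcup//.
  - rewrite sintegralE; apply: eq_fsbigr => y /set_mem[x _ <-].
    by apply/esym; exact: lebesgue_sector.
  - by move=> y z _ _ [x [[/= <- _] [/= <- _]]].
  - by move=> y _; exact: measurable_sector.
pose h := nnsfun_approx measurableT mEg.
have hg := cvg_nnsfun_approx measurableT mEg Eg0.
have ndh := nd_nnsfun_approx measurableT mEg.
rewrite -[X in _ = m X]/(S g).
(* The strict inequality in [S] matters: a point strictly below [g] is already strictly below some
   approximation. *)
have -> : S g = \bigcup_k S (h k).
  apply/seteqP; split => x.
    move=> [x0 xg]; have /fine_cvgP[_ /= hgx] := hg (radial x) I.
    have [k _ /(_ k (leqnn k))] := cvgr_gt _ hgx _ xg.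
    by move=> hk; exists k.
  move=> [k _ [x0 xh]]; split => //; apply: lt_le_trans xh _.
  by rewrite -lee_fin /h nnsfun_approxE; exact: le_approx.
have mS f : measurable_fun setT f -> measurable (S f) by exact: measurable_subgraph.
have mSh k : measurable (S (h k)) by apply: mS; exact: measurable_funP.
have : m \o (fun k => S (h k)) @ \oo --> m (\bigcup_k S (h k)).
  apply: nondecreasing_cvg_mu => //; first exact: bigcupT_measurable.
  move=> i j ij; apply/subsetPset => x [x0 xh]; split => //.
  by apply: lt_le_trans xh _; have /lefP := ndh _ _ ij; exact.
move=> /cvg_lim <- //; rewrite (@nd_ge0_integral_lim _ _ _ _ _ h)//.
- by congr (limn _); apply/funext => k /=; rewrite simple.
- by move=> x i j ij; have /lefP := ndh _ _ ij; exact.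
- by move=> x; exact: hg.
Qed.

End cone_distribution.

(** * The kernel and the limit *)

Lemma subr_split (R : comRingType) (A B C D : R) :
  A - B = (C - D) + ((A - C) - (B - D)).
Proof. by ring. Qed.

Lemma perturb_gt (R : realFieldType) (A V D rho u : R) :
  V <= A + D -> D <= (1 - rho) * u -> u < V -> rho * u < A.
Proof. by move=> *; lra. Qed.

(** The margin [(1 - rho) * u] also serves for raising the threshold, because
    [1 - rho <= rho^-1 - 1]. Here [V] stands for the size of [T nu], [A] for that of [c K] and [D]
    for their distance. *)
Lemma perturb_gt_inv (R : realFieldType) (A V D rho u : R) : 0 < rho -> 0 < u ->
  A <= V + D -> D <= (1 - rho) * u -> rho^-1 * u < A -> u < V.
Proof.
move=> rho0 u0 AV Du uA.
have rhoV : 1 - rho <= rho^-1 - 1.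
  rewrite -(ler_pM2r rho0) (mulrBl rho rho^-1) mulVf ?gt_eqF//.
  by have := sqr_ge0 (1 - rho); rewrite expr2; lra.
by have := ler_wpM2r (ltW u0) rhoV; lra.
Qed.

Section kernel.
Context (R : realType) (n : nat) (alpha r : R) (Omega : 'rV[R]_n -> R).
Local Notation m := (lebesgue R n).
Local Notation mu := (borel_lebesgue R n).
Local Notation V := 'rV[R]_n.
Context (halpha : 0 < alpha < n%:R) (hr : r = n%:R / (n%:R - alpha)).
Context (mOmega : measurable_fun (~` [set (0 : V)] : set (rVL R n)) Omega)
  (mOmegaS : measurable_fun setT (Omega : rVS R n -> R))
  (hom : forall (lambda : R) (x : V), 0 < lambda -> x != 0 -> Omega (lambda *: x) = Omega x).
Local Notation I := (\int[@cone_volume R n]_x (`|Omega x| `^ r)%:E)%E.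
Context (Ifin : (I < +oo)%E).

Local Notation a := (n%:R - alpha).

Definition kernel (x : V) : R := Omega x / enorm x `^ a.

Let a_gt0 : 0 < a. Proof. by have /andP[_] := halpha; rewrite subr_gt0. Qed.

Let n_gt0 : (0 < n)%N.
Proof.
by have /andP[h1 h2] := halpha; rewrite -(ltr_nat R); exact: lt_trans h2.
Qed.

Let r_gt0 : 0 < r.
Proof. by rewrite hr divr_gt0// ltr0n. Qed.

Let ar : a * r = n%:R.
Proof. by rewrite hr mulrCA divff ?mulr1// gt_eqF. Qed.

Let r_gt1 : 1 < r.
Proof.
by rewrite hr ltr_pdivlMr// mul1r gtrBl; case/andP: halpha.
Qed.

Lemma kernel0 : kernel 0 = 0.
Proof.
rewrite /kernel (_ : enorm 0 = 0) ?powR0 ?gt_eqF// ?invr0 ?mulr0//.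
by apply/eqP; rewrite enorm_eq0.
Qed.

Lemma kernelZ (s : R) (x : V) : 0 < s -> kernel (s *: x) = s `^ (- a) * kernel x.
Proof.
move=> s0; have [->|x0] := eqVneq x 0; first by rewrite scaler0 kernel0 mulr0.
rewrite /kernel hom// enormZ gtr0_norm// powRM ?ltW ?enorm_gt0//.
by rewrite invfM powRN mulrCA mulrA.
Qed.

Lemma measurable_kernel : measurable_fun setT (kernel : rVL R n -> R).
Proof.
have m0 : measurable (~` [set (0 : V)] : set (rVL R n)).
  rewrite (_ : ~` _ = (@enorm R n : rVL R n -> R) @^-1` `]0, +oo[%classic).
    by rewrite -[X in measurable X]setTI; exact: measurable_enorm_lebesgue.
  apply/seteqP; split => x /=; rewrite in_itv/= andbT enorm_gt0.
    by move=> x0; apply/eqP.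
  by move/eqP.
rewrite (_ : kernel = (fun x => (Omega \_ (~` [set (0 : V)])) x * enorm x `^ (- a))).
  apply: measurable_funM; first exact/(measurable_restrictT _ m0).
  exact: (measurableT_comp (@measurable_powR R (- a)) (@measurable_enorm_lebesgue R n)).
apply/funext => x; rewrite patchE powRN /kernel; case: ifPn => // /negP xE.
suff -> : x = 0 by have := kernel0; rewrite /kernel => ->; rewrite mul0r.
by apply: contrapT => x0; apply: xE; apply/mem_set.
Qed.

(** The level set is star-shaped about the origin, so its volume is an integral over directions of
    the power [n] of its radius. *)
Lemma lebesgue_kernel_gt (c u : R) : 0 <= c -> 0 < u ->
  (m [set x | (u < c * `|kernel x|)%R] = ((c / u) `^ r)%:E * I)%E.
Proof.
move=> c0 u0; have cu0 : 0 <= c / u by rewrite divr_ge0// ltW.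
have mabs : measurable_fun setT ((fun x => `|Omega x|) : rVS R n -> R).
  exact: (measurableT_comp (@normr_measurable R setT) mOmegaS).
have mw : measurable_fun setT ((fun x => (c / u * `|Omega x|) `^ r) : rVS R n -> R).
  apply: (measurableT_comp (@measurable_powR R r)).
  exact: (measurable_funM (measurable_cst (c / u)) mabs).
have mr : measurable_fun setT ((fun x => (`|Omega x| `^ r)%:E) : rVS R n -> \bar R).
  by apply/measurable_EFinP; exact: (measurableT_comp (@measurable_powR R r) mabs).
transitivity (\int[@cone_volume R n]_x ((c / u * `|Omega x|) `^ r)%:E)%E; last first.
  transitivity (\int[@cone_volume R n]_x (((c / u) `^ r)%:E * (`|Omega x| `^ r)%:E))%E.
    by apply: eq_integral => x _; rewrite -EFinM powRM.
  apply: ge0_integralZl => //.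
  by rewrite lee_fin powR_ge0.
rewrite (@integral_cone_volume R n n_gt0 (fun x => (c / u * `|Omega x|) `^ r)); last 2 first.
- exact: mw.
- by move=> x; exact: powR_ge0.
have key (x : V) : x != 0 -> (u < c * `|kernel x|) =
    (enorm x ^+ n < (c / u * `|Omega (radial x)|) `^ r).
  move=> x0; have e0 : 0 < enorm x by rewrite enorm_gt0.
  rewrite /kernel normrM normfV (ger0_norm (powR_ge0 _ _)) mulrA ltr_pdivlMr ?powR_gt0//.
  rewrite /radial hom ?invr_gt0//; set w := c / u * _.
  have w0 : 0 <= w by rewrite mulr_ge0.
  transitivity (enorm x `^ a < w); first by rewrite /w mulrAC ltr_pdivlMr// mulrC.
  have -> : enorm x ^+ n = (enorm x `^ a) `^ r by rewrite -powRrM ar powR_mulrn ?enorm_ge0.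
  apply/idP/idP.
    by apply: gt0_ltr_powR; rewrite ?nnegrE ?powR_ge0.
  rewrite !ltNge; apply: contra => we.
  by apply: ge0_ler_powR => //; rewrite ?nnegrE ?powR_ge0// ltW.
congr (m _); apply/seteqP; split => x /=; have [->|x0] := eqVneq x 0.
- by rewrite kernel0 normr0 mulr0 => /(lt_trans u0); rewrite ltxx.
- by rewrite key// enorm_gt0.
- by rewrite (_ : enorm 0 = 0) ?ltxx; [case|apply/eqP; rewrite enorm_eq0].
- by rewrite key// => -[].
Qed.

Definition kernel_gt (d : R) : V -> R := kernel \_ [set x | d < `|kernel x|].

Lemma kernel_gtE d x : kernel_gt d x = if d < `|kernel x| then kernel x else 0.
Proof.
by rewrite /kernel_gt patchE; case: ifPn => [/set_mem/= ->//|/negP xE];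
  case: ifPn => // xd; exfalso; apply: xE; apply/mem_set.
Qed.

Lemma measurable_kernel_gt d : measurable_fun setT (kernel_gt d : rVL R n -> R).
Proof.
have mS : measurable ([set x | d < `|kernel x|] : set (rVL R n)).
  rewrite (_ : [set x | _] = ((fun x => `|kernel x|) : rVL R n -> R) @^-1` `]d, +oo[%classic).
    rewrite -[X in measurable X]setTI.
    exact: (measurableT_comp (@normr_measurable R setT) measurable_kernel).
  by apply/seteqP; split => x /=; rewrite in_itv/= andbT.
exact/(measurable_restrictT _ mS)/(measurable_funS measurableT (@subsetT _ _) measurable_kernel).
Qed.

(* Dyadic decomposition of the level sets of the kernel, whose measures are
   [O(u ^ - r)]: since [1 < r] the resulting series is geometric. *)
Lemma integrable_kernel_gt (d : R) (N : set V) : 0 < d ->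
  measurable_fun setT (kernel_gt d \_ (~` N)) ->
  mu.-integrable setT (EFin \o (kernel_gt d \_ (~` N))).
Proof.
move=> d0; set f := _ \_ _ => mf.
have mabs : measurable_fun setT (fun x => `|f x|) by exact: measurableT_comp.
apply/integrableP; split; first exact/measurable_EFinP.
have f_le x : `|f x| <= `|kernel x|.
  by rewrite /f patchE; case: ifP => _; rewrite ?normr0// kernel_gtE; case: ifP; rewrite ?normr0.
have f_gt x : f x != 0 -> d < `|f x|.
  rewrite /f patchE; case: ifP => _; rewrite ?eqxx// kernel_gtE.
  by case: ifPn; rewrite ?eqxx.
pose t j := 2 ^+ j * d.
have t0 j : 0 < t j by rewrite mulr_gt0// exprn_gt0.
pose L j := [set x | t j < `|f x|].
have mL j : measurable (L j).
  rewrite (_ : L j = (fun x => `|f x|) @^-1` `]t j, +oo[%classic).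
    by rewrite -[X in measurable X]setTI; exact: mabs.
  by apply/seteqP; split => x /=; rewrite in_itv/= andbT.
(* On the shell [t j < |f x| <= t j.+1] the single term [u j x] already dominates [|f x|]. The
   shells exhaust the support of [f], as a nonzero value exceeds [d = t 0] in size. *)
pose u j x := (t j.+1 * \1_(L j) x)%:E.
have u0 j x : (0 <= u j x)%E by rewrite lee_fin mulr_ge0// ltW.
have mu_ j : measurable_fun setT (u j).
  by apply/measurable_EFinP; apply: measurable_funM => //; exact: measurable_indic.
have fu x : (`|f x|%:E <= \sum_(j <oo) u j x)%E.
  have [->|fx0] := eqVneq (f x) 0; first by rewrite normr0; exact: nneseries_ge0.
  have ex : exists j, `|f x| <= t j.
    have [k fk] : exists k, `|f x| / d < 2 ^+ k.
      exists (Num.trunc (`|f x| / d)).+1; apply: lt_le_trans (truncnS_gt _) _.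
      by rewrite -natrX ler_nat ltnW// ltn_expl.
    by exists k; rewrite -ler_pdivrMr// ltW.
  case: (ex_minnP ex) => -[|j] fj minj.
    by exfalso; move: (f_gt x fx0); rewrite ltNge; move: fj; rewrite /t expr0 mul1r => ->.
  have fj' : t j < `|f x|.
    by rewrite ltNge; apply/negP => /minj; rewrite ltnn.
  apply: (@le_trans _ _ (u j x)).
    by rewrite lee_fin indicE mem_set ?mulr1.
  apply: le_trans (nneseries_lim_ge j.+1 _); last by [].
  by rewrite big_nat_recr//= leeDr// sume_ge0.
apply: (@le_lt_trans _ _ (\int[mu]_x \sum_(j <oo) u j x)%E).
  apply: ge0_le_integral => //.
  - exact/measurable_EFinP.
  - exact: ge0_emeasurable_sum.
  - by move=> x _; exact: fu.
rewrite integral_nneseries//.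
pose i := fine I.
have I0 : (0 <= I)%E by apply: integral_ge0 => x _; rewrite lee_fin powR_ge0.
have Ii : I = i%:E by rewrite fineK// ge0_fin_numE.
have i0 : 0 <= i by rewrite fine_ge0.
(* The level set at height [t j] has measure at most [(t j)^-r I]. Multiplied by [t j.+1], this is
   [A q^j] with [A = 2 d^(1-r) I] and [q = 2^(1-r)]. *)
pose A := 2 * d * (d^-1) `^ r * i.
have A0 : 0 <= A by rewrite mulr_ge0// mulr_ge0 ?powR_ge0// mulr_ge0// ltW.
pose q : R := 2 * (2^-1) `^ r.
have q0 : 0 < q by rewrite mulr_gt0// powR_gt0.
have q1 : `|q| < 1.
  have h2 : 0 < (2^-1 : R) < 1 by rewrite invr_gt0 invf_lt1 ?ltr0n//= ltr1n.
  rewrite gtr0_norm// /q -ltr_pdivlMl// mulr1 -[ltRHS]powRr1//.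
  by rewrite /powR gt_eqF// ltr_expR ltr_nM2r// ln_lt0.
apply: (@le_lt_trans _ _ (\sum_(j <oo) (A * q ^+ j)%:E)%E).
  apply: lee_nneseries => j _; first by move=> _; exact: integral_ge0.
  have -> : (\int[mu]_x u j x = (t j.+1)%:E * mu (L j))%E.
    rewrite -[L j]setIT -integral_indic// -ge0_integralZl//.
    - by apply/measurable_EFinP; exact: measurable_indic.
    - by rewrite lee_fin ltW.
  have -> : A * q ^+ j = t j.+1 * ((1 / t j) `^ r * i).
    rewrite /A /q /t exprMn exprS div1r invfM powRM ?invr_ge0 ?exprn_ge0 ?ltW//.
    by rewrite -exprVn -!powR_mulrn ?powR_ge0 ?invr_ge0// powRAC; ring.
  rewrite [leRHS]EFinM lee_pmul2l ?lte_fin//; apply: (@le_trans _ _ (m (L j))).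
    by rewrite lebesgue_borelE.
  rewrite [leRHS]EFinM -Ii -lebesgue_kernel_gt//; apply: le_lebesgue => x /= fx.
  by rewrite mul1r (lt_le_trans fx).
apply: (@le_lt_trans _ _ (A * (1 - q)^-1)%:E); last exact: ltry.
apply: lime_le.
  by apply: is_cvg_nneseries => j _ _; rewrite lee_fin mulr_ge0// exprn_ge0// ltW.
apply: nearW => k; rewrite sumEFin lee_fin.
exact: geometric_le_lim.
Qed.


Lemma kernel_gt_scale (d lam : R) (x : V) : 0 < lam ->
  kernel_gt (d * lam) x = lam * kernel_gt d (lam `^ a^-1 *: x).
Proof.
move=> l0; rewrite !kernel_gtE.
have -> : kernel x = lam * kernel (lam `^ a^-1 *: x).
  rewrite kernelZ ?powR_gt0// -powRrM mulrN mulVf ?gt_eqF// powR_inv1 ?ltW//.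
  by rewrite mulrA divff ?gt_eqF// mul1r.
rewrite normrM gtr0_norm// mulrC ltr_pM2l//.
by case: ifP => // _; rewrite mulr0.
Qed.

(** * Convolution of the kernel with a finite measure *)

Section convolution.
Context (P : {finite_measure set (rVL R n) -> \bar R}) (P_ac : P `<< lebesgue R n).
Local Notation p := (fine (P setT)).

Definition deviation (d : R) (x : V) : \bar R :=
  (\int[P]_y `|kernel_gt d (x - y)%R - kernel_gt d x|%:E)%E.

Let measurable_reflect (f : V -> R) (x : V) :
  measurable_fun setT (f : rVL R n -> R) ->
  measurable_fun setT ((fun y => f (x - y)) : rVL R n -> R).
Proof.
move=> mf; rewrite (_ : (fun y => _) = f \o rV_aff (- 1) x); last first.
  by apply/funext => y /=; rewrite /rV_aff scaleN1r addrC.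
apply: (measurableT_comp mf); apply: measurable_rV_aff_lebesgue.
by rewrite oppr_eq0 oner_eq0.
Qed.

(** Truncation changes the kernel by at most [d], once at [x - y] and once at [x], which after
    integration gives [2 * d * p]. Finiteness of the convolution is part of the conclusion: the same
    bound makes the difference from the constant [kernel x] integrable. *)
Lemma convolution_deviation (d b : R) (x : V) : 0 <= d ->
  (deviation d x <= b%:E)%E ->
  exists2 v : R, (\int[P]_y (kernel (x - y))%:E = v%:E)%E &
    `|v - kernel x * p| <= b + 2 * d * p.
Proof.
move=> d0 db.
have pE : P setT = p%:E by rewrite fineK// fin_num_measure.
have mT : measurable ([set: V] : set (rVL R n)) by exact: measurableT.
have cstE (w : R) : (\int[P]_y cst w%:E y = (w * p)%:E)%E.
  by rewrite integral_cst// EFinM -pE.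
have mk := measurable_reflect x measurable_kernel.
have mg := measurable_reflect x (measurable_kernel_gt d).
have mD : measurable_fun setT ((fun y => kernel (x - y) - kernel x) : rVL R n -> R).
  by apply: measurable_funB; [exact: mk|exact: measurable_cst].
have mE : measurable_fun setT ((fun y => kernel_gt d (x - y) - kernel_gt d x) : rVL R n -> R).
  by apply: measurable_funB; [exact: mg|exact: measurable_cst].
have mnD : measurable_fun setT ((fun y => `|kernel (x - y) - kernel x|%:E) : rVL R n -> \bar R).
  by apply/measurable_EFinP; exact: (measurableT_comp (@normr_measurable R setT) mD).
have mnE : measurable_fun setT ((fun y => `|kernel_gt d (x - y) - kernel_gt d x|%:E) : rVL R n -> \bar R).
  by apply/measurable_EFinP; exact: (measurableT_comp (@normr_measurable R setT) mE).
have mc (w : R) : measurable_fun setT (cst w%:E : rVL R n -> \bar R) by exact: measurable_cst.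
have trunc z : `|kernel z - kernel_gt d z| <= d.
  by rewrite kernel_gtE; case: ltP => zd; rewrite ?subrr ?normr0 ?subr0.
have intD : (\int[P]_y `|kernel (x - y) - kernel x|%:E <= (b + 2 * d * p)%:E)%E.
  apply: (@le_trans _ _ (\int[P]_y (`|kernel_gt d (x - y) - kernel_gt d x|%:E + (2 * d)%:E))%E).
    apply: ge0_le_integral; [exact: mT|by move=> y _; rewrite lee_fin|exact: mnD|
      by apply: emeasurable_funD; [exact: mnE|exact: mc]|].
    move=> y _; rewrite -EFinD lee_fin.
    rewrite [X in `|X| <= _](subr_split _ _ (kernel_gt d (x - y)) (kernel_gt d x)).
    rewrite (le_trans (ler_normD _ _))// lerD2l (le_trans (ler_normB _ _))//.
    by rewrite mulr_natl mulr2n lerD.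
  rewrite ge0_integralD; [|exact: mT|by move=> y _; rewrite lee_fin|exact: mnE|
    by move=> y _; rewrite lee_fin mulr_ge0|exact: mc].
  by rewrite EFinD cstE leeD2r.
have mDe : measurable_fun setT ((fun y => (kernel (x - y) - kernel x)%:E) : rVL R n -> \bar R).
  exact/measurable_EFinP.
have iD : P.-integrable setT ((fun y => (kernel (x - y) - kernel x)%:E) : rVL R n -> \bar R).
  apply/integrableP; split; first exact: mDe.
  by apply: le_lt_trans intD (ltry _).
have ic : P.-integrable setT (cst (kernel x)%:E : rVL R n -> \bar R).
  by apply: finite_measure_integrable_cst; exact: mT.
have kE : (\int[P]_y (kernel (x - y))%:E =
    \int[P]_y (kernel (x - y) - kernel x)%:E + (kernel x * p)%:E)%E.
  transitivity (\int[P]_y ((kernel (x - y) - kernel x)%R%:E + cst (kernel x)%:E y))%E.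
    by apply: eq_integral => y _; rewrite -EFinD subrK.
  by rewrite integralD// cstE.
have Dfin : (\int[P]_y (kernel (x - y) - kernel x)%:E)%E \is a fin_num.
  exact: integrable_fin_num.
exists (fine (\int[P]_y (kernel (x - y) - kernel x)%:E)%E + kernel x * p).
  by rewrite kE EFinD fineK.
rewrite addrK -lee_fin; apply: le_trans intD.
rewrite -(fineK Dfin) -abse_EFin fineK//.
exact: (le_abse_integral P mT mDe).
Qed.

Lemma small_deviation (d t : R) (u : nat -> R) : 0 < d -> 0 < t ->
  (forall j, 0 < u j) -> u @ \oo --> (0 : R) ->
  small (fun j => (u j `^ r)%:E * m [set x | ((t * u j)%:E < deviation (d * u j) x)%E])%E.
Proof.
move=> d0 t0 u_gt0 u0.
have [N [mN N0 mkN]] := borel_version (measurable_kernel_gt d).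
have iN := integrable_kernel_gt d0 mkN.
pose e_ j := u j `^ a^-1.
have e_gt0 j : 0 < e_ j by rewrite powR_gt0.
have e0 : e_ @ \oo --> (0 : R).
  have a1 : 0 < a^-1 by rewrite invr_gt0.
  by have /cvg_at_rightP/(_ u) := powR_cvg0 a1; apply.
have := small_averaged_translation P_ac (measurable_kernel_gt d) mN N0 mkN iN e_gt0 e0 t0.
apply: small_le; apply: nearW => j.
have en0 : e_ j != 0 by rewrite gt_eqF.
(* The weight cancels the Jacobian of the dilation by [e_ j], since [a^-1 * n = r]. *)
have E1 : u j `^ r * e_ j ^- n = 1.
  rewrite /e_ -powR_mulrn ?powR_ge0// -powRrM (_ : a^-1 * n%:R = r).
    by rewrite divff// gt_eqF// powR_gt0.
  by rewrite hr mulrC.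
have scaleS (S : set V) :
    ((u j `^ r)%:E * m (rV_aff (e_ j) 0 @^-1` S) <= m S)%E.
  rewrite (lebesgue_aff 0 S en0) (gtr0_norm (e_gt0 j)).
  by rewrite muleA -EFinM E1 mul1e.
pose S := [set z | (t%:E <
  \int[P]_y `|kernel_gt d (z - e_ j *: y)%R - kernel_gt d z|%:E)%E].
(* By homogeneity the truncation at height [d * u j] becomes, after the dilation, the truncation at
   [d]; a single function and a single null set [N] thus serve for all [j]. *)
have scale x : deviation (d * u j) x =
    ((u j)%:E * \int[P]_y `|kernel_gt d (e_ j *: x - e_ j *: y)%R - kernel_gt d (e_ j *: x)|%:E)%E.
  rewrite -ge0_integralZl; last 4 first.
  - exact: measurableT.
  - apply/measurable_EFinP; apply: (measurableT_comp (@normr_measurable R setT)).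
    apply: measurable_funB; last exact: measurable_cst.
    rewrite (_ : (fun y => _) = (fun y => kernel_gt d (e_ j *: y)) \o (fun y => x - y)); last first.
      by apply/funext => y /=; rewrite scalerBr.
    apply: (measurable_reflect (f := fun y => kernel_gt d (e_ j *: y))).
    rewrite (_ : (fun y => _) = kernel_gt d \o rV_aff (e_ j) 0).
      apply: (measurableT_comp (measurable_kernel_gt d)).
      by apply: measurable_rV_aff_lebesgue; rewrite gt_eqF.
    by apply/funext => y /=; rewrite /rV_aff addr0.
  - by move=> y _; rewrite lee_fin.
  - by rewrite lee_fin ltW.
  apply: eq_integral => y _; rewrite -EFinM !(kernel_gt_scale _ _ (u_gt0 j)) -mulrBr normrM.
  by rewrite (gtr0_norm (u_gt0 j)) /e_ -scalerBr.
have -> : [set x | ((t * u j)%:E < deviation (d * u j) x)%E] = rV_aff (e_ j) 0 @^-1` S.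
  by apply/seteqP; split => x; rewrite /= scale /S/= /rV_aff addr0;
    rewrite EFinM muleC lte_pmul2l// ?lte_fin.
exact: scaleS.
Qed.

End convolution.


(** * Signed measures and passage to the limit *)

Section fractional.
Context (nu : {charge set (rVL R n) -> \bar R}) (nu_ac : nu `<< lebesgue R n).
Local Notation P := (jordan_pos (hahn_posneg nu)).
Local Notation Q := (jordan_neg (hahn_posneg nu)).
Local Notation p := (fine (P setT)).
Local Notation q := (fine (Q setT)).
Local Notation c := `|p - q|.
Local Notation T := (fractional_integral Omega alpha nu).

Lemma charge_setT : nu setT = (p - q)%:E.
Proof.
have mT : measurable ([set: V] : set (rVL R n)) by exact: measurableT.
rewrite (jordan_decomp (hahn_posneg nu) mT) /cadd/= /cscale/= EFinD EFinN mulN1e.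
by rewrite EFinN !fineK ?fin_num_measure.
Qed.

Lemma fractional_integral_kernel (t d : R) (x : V) : 0 <= d ->
  (deviation P d x <= t%:E)%E -> (deviation Q d x <= t%:E)%E ->
  exists2 v : R, T x = v%:E & `|v - kernel x * (p - q)| <= 2 * t + 2 * d * (p + q).
Proof.
move=> d0 dP dQ.
have [v vE vK] := convolution_deviation d0 dP.
have [w wE wK] := convolution_deviation d0 dQ.
exists (v - w).
  by rewrite /fractional_integral /charge_integral EFinB -vE -wE.
have -> : v - w - kernel x * (p - q) = (v - kernel x * p) - (w - kernel x * q) by ring.
rewrite (le_trans (ler_normB _ _))//.
have -> : 2 * t + 2 * d * (p + q) = (t + 2 * d * p) + (t + 2 * d * q) by ring.
exact: lerD.
Qed.

Lemma fractional_integral_sandwich (kappa : R) (u : nat -> R) :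
  1 < kappa -> (forall j, 0 < u j) -> u @ \oo --> (0 : R) ->
  exists2 b : nat -> \bar R, small b & forall j,
    ((u j `^ r)%:E * m [set x | ((u j)%:E < `|T x|)%E] <=
       kappa%:E * ((c `^ r)%:E * I) + b j)%E /\
    ((kappa^-1)%:E * ((c `^ r)%:E * I) <=
       (u j `^ r)%:E * m [set x | ((u j)%:E < `|T x|)%E] + b j)%E.
Proof.
move=> k1 u_gt0 u0.
have k0 : 0 < kappa by exact: lt_trans k1.
(* Moving the threshold from [u] to [rho * u] or [rho^-1 * u] multiplies the distribution of [c K]
   by [rho^-r = kappa] or its inverse. *)
pose rho := kappa `^ (- r^-1).
have rho0 : 0 < rho by rewrite powR_gt0.
have rhoV : rho^-1 `^ r = kappa.
  by rewrite /rho powRN invrK -powRrM mulVf ?gt_eqF// powRr1 ?ltW.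
have rhor : rho `^ r = kappa^-1.
  by rewrite /rho -powRrM mulNr mulVf ?gt_eqF// powR_inv1// ltW.
have rho1 : rho < 1.
  rewrite ltNge; apply/negP => rho1.
  have := ge0_ler_powR (ltW r_gt0) (x := 1) (y := rho).
  rewrite !nnegrE powR1 rhor => /(_ ler01 (ltW rho0) rho1).
  by rewrite leNgt invf_lt1 ?k1.
have p0 : 0 <= p by rewrite fine_ge0.
have q0 : 0 <= q by rewrite fine_ge0.
pose eta := 1 - rho.
have eta0 : 0 < eta by rewrite subr_gt0.
(* The error [2 t + 2 d (p + q)] has to stay below [eta]: each summand gets [eta / 2]. The [+ 1]
   keeps the denominator positive when both parts of [nu] vanish. *)
pose t := eta / 4; pose d := eta / (4 * (p + q + 1)).
have pq1 : 0 < p + q + 1 by rewrite ltr_wpDl// addr_ge0.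
have t0 : 0 < t by rewrite divr_gt0.
have d0 : 0 < d by rewrite divr_gt0// mulr_gt0.
have dpq : 2 * d * (p + q) <= eta / 2.
  rewrite (_ : eta / 2 = 2 * d * (p + q + 1)); last by rewrite /d; field; rewrite gt_eqF.
  by apply: ler_wpM2l; rewrite ?lerDl// mulr_ge0// ltW.
pose B (X : {finite_measure set (rVL R n) -> \bar R}) j : set V :=
  [set x | ((t * u j)%:E < deviation X (d * u j) x)%E].
have sP := small_deviation (jordan_pos_dominates (hahn_posneg nu) nu_ac) d0 t0 u_gt0 u0.
have sQ := small_deviation (jordan_neg_dominates (hahn_posneg nu) nu_ac) d0 t0 u_gt0 u0.
exists (fun j => (u j `^ r)%:E * m (B P j) + (u j `^ r)%:E * m (B Q j))%E.
  exact: smallD sP sQ.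
move=> j.
have good x : ~ (B P j `|` B Q j) x ->
    exists2 v : R, T x = v%:E & `|v - kernel x * (p - q)| <= eta * u j.
  move=> /not_orP[/negP]; rewrite -leNgt => dP /negP; rewrite -leNgt => dQ.
  have du : 0 <= d * u j by rewrite mulr_ge0 ?ltW.
  have [v vE vK] := fractional_integral_kernel du dP dQ.
  exists v => //; apply: (le_trans vK).
  rewrite (_ : 2 * (t * u j) + _ = (eta / 2 + 2 * d * (p + q)) * u j); last first.
    by rewrite /t; field.
  by rewrite ler_pM2r// [leRHS](splitr eta) lerD2l.
have lr0 : 0 <= u j `^ r by exact: powR_ge0.
have split (A X : set V) : A `<=` X `|` (B P j `|` B Q j) ->
    ((u j `^ r)%:E * m A <= (u j `^ r)%:E * m X +
      ((u j `^ r)%:E * m (B P j) + (u j `^ r)%:E * m (B Q j)))%E.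
  move=> AX; have m0 (S : set V) : (0 <= m S)%E by exact: mu_ext_ge0.
  rewrite -!ge0_muleDr ?adde_ge0//; apply: lee_wpmul2l; first by rewrite lee_fin.
  apply: le_trans (le_lebesgue AX) _; apply: le_trans (lebesgueU_le _ _) _.
  by apply: leeD2l; exact: lebesgueU_le.
have dist (s : R) : 0 < s ->
    ((u j `^ r)%:E * m [set x | (s * u j < c * `|kernel x|)%R] =
     (s^-1 `^ r)%:E * ((c `^ r)%:E * I))%E.
  move=> s0; rewrite lebesgue_kernel_gt ?mulr_gt0//.
  rewrite !muleA -!EFinM; congr (_%:E * _)%E.
  have si : 0 <= s^-1 by rewrite invr_ge0 ltW.
  have ui : 0 <= (u j)^-1 by rewrite invr_ge0 ltW.
  have uu : u j `^ r * (u j)^-1 `^ r = 1.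
    by rewrite -powRM// ?ltW// divff ?gt_eqF// powR1.
  rewrite invfM (powRM _ (normr_ge0 _) (mulr_ge0 si ui)) (powRM _ si ui).
  transitivity ((u j `^ r * (u j)^-1 `^ r) * (s^-1 `^ r * c `^ r)); first by ring.
  by rewrite uu mul1r.
split.
  rewrite -rhoV -dist//; apply: split => x /= uT.
  have [Bx|/good[v vE vK]] := pselect ((B P j `|` B Q j) x); [by right|left => /=].
  move: uT; rewrite vE lte_fin => uv.
  have ck : c * `|kernel x| = `|kernel x * (p - q)| by rewrite [RHS]normrM; exact: mulrC.
  rewrite ck; apply: (perturb_gt _ vK uv).
  have := ler_normD (kernel x * (p - q)) (v - kernel x * (p - q)).
  by rewrite addrC subrK.
have rV : 0 < rho^-1 by rewrite invr_gt0.
have := dist _ rV; rewrite invrK rhor => <-; apply: split => x /= uT.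
have [Bx|/good[v vE vK]] := pselect ((B P j `|` B Q j) x); [by right|left => /=].
rewrite vE lte_fin.
have ck : c * `|kernel x| = `|kernel x * (p - q)| by rewrite [RHS]normrM; exact: mulrC.
rewrite ck in uT; apply: (perturb_gt_inv rho0 (u_gt0 j) _ vK uT).
by have := ler_normB v (v - kernel x * (p - q)); rewrite subKr.
Qed.


Lemma cvg_distribution_fractional_integral :
  ((lam `^ r)%:E * m [set x | (lam%:E < `|T x|)%E])%E @[lam --> (0 : R)^'+]
    --> ((c `^ r)%:E * I)%E.
Proof.
have I0 : (0 <= I)%E by apply: integral_ge0 => x _; rewrite lee_fin powR_ge0.
have IE : I = (fine I)%:E by rewrite fineK// ge0_fin_numE.
have [l lE] : exists l : R, ((c `^ r)%:E * I = l%:E)%E.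
  by exists (c `^ r * fine I); rewrite EFinM -IE.
have l0 : 0 <= l by rewrite -lee_fin -lE mule_ge0// lee_fin powR_ge0.
(* Sequences suffice for a one-sided limit, and dominated convergence is sequential. *)
rewrite lE; apply/cvge_at_rightP => u [u_gt0 u0].
set f := fun j => ((u j `^ r)%:E * m [set x | ((u j)%:E < `|T x|)%E])%E.
have f0 j : (0 <= f j)%E by rewrite mule_ge0 ?mu_ext_ge0// lee_fin powR_ge0.
have bounds (e : R) : 0 < e ->
    \forall j \near \oo, (f j <= (l + e)%:E)%E /\ (l%:E <= f j + e%:E)%E.
  move=> e0; have l1 : 0 < l + 1 by rewrite ltr_wpDl.
  (* Chosen so that [(kappa - 1) * l <= e / 2], which also bounds [(1 - kappa^-1) * l]; the other
     half of [e] absorbs [b j]. *)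
  pose k0 := e / 2 / (l + 1); pose kappa := 1 + k0.
  have k0_gt0 : 0 < k0 by rewrite !divr_gt0.
  have k1 : 1 < kappa by rewrite ltrDl.
  have k0l : k0 * l <= e / 2.
    by rewrite /k0 mulrAC ler_pdivrMr// ler_wpM2l ?lerDl// divr_ge0// ltW.
  have [b sb fb] := fractional_integral_sandwich k1 u_gt0 u0.
  have e2 : 0 < e / 2 by rewrite divr_gt0.
  have := sb _ e2; apply: filterS => j bj; have [] := fb j; rewrite lE => h1 h2.
  split.
    apply: (le_trans h1); apply: (@le_trans _ _ ((kappa * l)%:E + (e / 2)%:E)%E).
      by rewrite EFinM leeD2l.
    by rewrite -EFinD lee_fin /kappa mulrDl mul1r -addrA lerD2l; lra.
  have h3 : l <= kappa^-1 * l + e / 2.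
    rewrite -lerBlDr -(ler_pM2l (lt_trans ltr01 k1)) mulrA divff ?mul1r; last first.
      by rewrite gt_eqF// (lt_trans ltr01 k1).
    rewrite /kappa mulrDl mul1r mulrBr.
    have h4 : 0 <= k0 * (e / 2) by rewrite mulr_ge0 ?ltW.
    by lra.
  apply: (@le_trans _ _ ((kappa^-1 * l)%:E + (e / 2)%:E)%E).
    by rewrite -EFinD lee_fin.
  have -> : (e%:E = (e / 2)%:E + (e / 2)%:E)%E by rewrite -EFinD -splitr.
  rewrite addeA leeD2r// EFinM.
  by apply: le_trans h2 _; exact: leeD2l.
have ffin : \forall j \near \oo, f j \is a fin_num.
  have := bounds _ ltr01; apply: filterS => j [fl _].
  by rewrite ge0_fin_numE// (le_lt_trans fl) ?ltry.
apply/fine_cvgP; split => //; apply/cvgrPdist_le => e e0.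
near=> j; have fj : f j \is a fin_num by near: j.
have [] : (f j <= (l + e)%:E)%E /\ (l%:E <= f j + e%:E)%E by near: j; exact: bounds.
rewrite -(fineK fj) -EFinD !lee_fin /= => h1 h2.
by rewrite ler_norml; apply/andP; split; lra.
Unshelve. all: by end_near. Qed.

End fractional.

End kernel.

Theorem theorem1p5 (R : realType) (n : nat) (alpha r : R)
    (nu : {charge set (rVL R n) -> \bar R}) (Omega : 'rV[R]_n -> R)
    (halpha : 0 < alpha < n%:R)
    (hr : r = n%:R / (n%:R - alpha))
    (hnu_ac : nu `<< lebesgue R n)
    (hnu_fin : (charge_total_variation nu setT < +oo)%E)
    (hOmega_meas : measurable_fun (~` [set (0 : 'rV[R]_n)] : set (rVL R n)) Omega)
    (hOmega_hom : forall (lambda : R) (x : 'rV[R]_n),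
        0 < lambda -> x != 0 -> Omega (lambda *: x) = Omega x)
    (hOmega_mean :
        (\int[surface R n]_(theta in unit_sphere R n) (Omega theta)%:E = 0)%E)
    (hOmega_dini : dini r%:E alpha Omega) :
  ((lambda `^ r)%:E *
     lebesgue R n [set x | (lambda%:E < `|fractional_integral Omega alpha nu x|)%E])%E
    @[lambda --> (0 : R)^'+]
  --> ((n%:R^-1)%:E * ('N[surface R n]_(r%:E) [EFin \o Omega]) `^ r
       * `|nu setT| `^ r)%E.
Proof.
have n0 : 0 < n%:R :> R by have /andP[] := halpha; exact: lt_trans.
have r0 : 0 < r by rewrite hr divr_gt0// subr_gt0; case/andP: halpha.
have [OmegaL _] := hOmega_dini.
have mOmegaS : measurable_fun setT (Omega : rVS R n -> R).
  exact: (set_mem (sub_Lfun_mfun OmegaL)).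
(* The surface measure is [n] times the cone volume; this [n] cancels the factor [1 / n] of the
   limit. *)
have NE : ('N[surface R n]_(r%:E) [EFin \o Omega] `^ r =
    n%:R%:E * \int[@cone_volume R n]_x (`|Omega x| `^ r)%:E)%E.
  have mf : measurable_fun setT ((fun x => (`|Omega x| `^ r)%:E) : rVS R n -> \bar R).
    apply/measurable_EFinP; apply: (measurableT_comp (@measurable_powR R r)).
    exact: (measurableT_comp (@normr_measurable R setT) mOmegaS).
  rewrite poweR_Lnorm ?gt_eqF//.
  apply: (@ge0_integral_mscale _ _ _ (@cone_volume R n) setT measurableT (n%:R%:nng) _ mf).
  by move=> x _; rewrite lee_fin powR_ge0.
have Ifin : (\int[@cone_volume R n]_x (`|Omega x| `^ r)%:E < +oo)%E.
  have : ('N[surface R n]_(r%:E) [EFin \o Omega] `^ r < +oo)%E.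
    exact: poweR_lty (set_mem (sub_Lfun_finLfun OmegaL)).
  have n0E : (0 < n%:R%:E :> \bar R)%E by rewrite lte_fin.
  by rewrite NE -[in X in _ -> X](@lte_pmul2l _ n%:R%:E)// gt0_muley.
have := cvg_distribution_fractional_integral halpha hr hOmega_meas mOmegaS hOmega_hom Ifin hnu_ac.
rewrite NE muleA -EFinM mulVf ?gt_eqF// mul1e charge_setT.
by rewrite abse_EFin poweR_EFin muleC.
Qed.
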